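(* Let $\mathfrak{n}$ be a $7$-dimensional $2$-step nilpotent real Lie algebra with derived algebra $\mathfrak{n}'=[\mathfrak{n},\mathfrak{n}]$. If $\mathfrak{n}$ is irreducible and $\dim(\mathfrak{n}')=2$, then $\mathfrak{n}$ carries no coclosed $\mathrm{G}_2$-structures. If $\mathfrak{n}$ is either reducible, or $\dim(\mathfrak{n}')\neq 2$, then every metric (inner product) on $\mathfrak{n}$ is induced by a coclosed $\mathrm{G}_2$-structure, i.e., for every inner product $g$ on $\mathfrak{n}$ there exists a coclosed $\mathrm{G}_2$-structure $\varphi$ on $\mathfrak{n}$ with $g_\varphi=g$.
   Context: A Lie algebra is $2$-step nilpotent if it is non-abelian and its derived algebra is contained in its center. A Lie algebra is reducible (decomposable) if it is a direct sum of two non-zero ideals, and irreducible (indecomposable) otherwise. $\mathrm{d}$ denotes the Chevalley-Eilenberg differential on $\Lambda^\bullet\mathfrak{n}^*$ ($\mathrm{d}\alpha(x,y)=-\alpha([x,y])$ for $\alpha\in\mathfrak{n}^*$, extended as a graded derivation). A $\mathrm{G}_2$-structure on a $7$-dimensional real vector space $V$ is a $3$-form $\varphi\in\Lambda^3V^*$ such that $(v\lrcorner\varphi)\wedge(v\lrcorner\varphi)\wedge\varphi\neq0$ for all $v\in V\smallsetminus\{0\}$. It determines a unique inner product $g_\varphi$ and orientation, with volume form $\mathrm{vol}_\varphi$, such that $g_\varphi(v,w)\mathrm{vol}_\varphi=\frac16\,(v\lrcorner\varphi)\wedge(w\lrcorner\varphi)\wedge\varphi$; $*_\varphi$ is the corresponding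 Hodge operator. A $\mathrm{G}_2$-structure $\varphi$ on $\mathfrak{n}$ (i.e., on the vector space underlying $\mathfrak{n}$) is coclosed if $\mathrm{d}*_\varphi\varphi=0$. *)

(* Defs.v *)
From mathcomp Require Import all_boot all_order all_fingroup all_algebra.
From mathcomp Require Import reals.

Set Implicit Arguments.
Unset Strict Implicit.
Unset Printing Implicit Defensive.

Import Order.TTheory GRing.Theory Num.Theory.
Local Open Scope ring_scope.

Section ExteriorAlgebra.
Variables (R : realType) (V : vectType R).

(* A k-form is a function ('I_k -> V) -> R satisfying [is_form]; the operations
   below are defined on all functions of that type. *)
Definition is_form k (a : ('I_k -> V) -> R) : Prop :=
  (forall (x : 'I_k -> V) (i : 'I_k),
     scalar (fun u : V => a (@dfwith _ (fun=> V) x i u)))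
  /\ (forall (x : 'I_k -> V) (i j : 'I_k), i != j -> x i = x j -> a x = 0).

(* Normalised so that (a /\ b)(x, y) = a x * b y - a y * b x for 1-forms. *)
Definition wedge p q (a : ('I_p -> V) -> R) (b : ('I_q -> V) -> R) :
    ('I_(p + q) -> V) -> R :=
  fun x => ((p`! * q`!)%N%:R)^-1 * \sum_(s : 'S_(p + q)) (-1) ^+ s *
    (a (fun i => x (s (lshift q i))) * b (fun j => x (s (rshift p j)))).

Definition vcons k (v : V) (x : 'I_k -> V) : 'I_k.+1 -> V :=
  fun i => if unlift ord0 i is Some j then x j else v.

Definition vcat p q (x : 'I_p -> V) (y : 'I_q -> V) : 'I_(p + q) -> V :=
  fun i => match split i with inl j => x j | inr j => y j end.

Definition interior k (v : V) (a : ('I_k.+1 -> V) -> R) : ('I_k -> V) -> R :=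
  fun x => a (vcons v x).

Definition inv_gram (g : {dot V for idfun}) : 'M[R]_(\dim {:V}) :=
  invmx (\matrix_(i, j) g (tnth (vbasis {:V}) i) (tnth (vbasis {:V}) j)).

(* The inner product induced by g on k-forms,
   <a, b> = 1/k! sum g^(i1 j1) ... g^(ik jk) a_(i1...ik) b_(j1...jk);
   it does not depend on the basis, and makes e^(i1) /\ ... /\ e^(ik),
   i1 < ... < ik, orthonormal when e is a g-orthonormal basis. *)
Definition form_inner (g : {dot V for idfun}) k (a b : ('I_k -> V) -> R) : R :=
  (k`!%:R)^-1 *
  \sum_(I : {ffun 'I_k -> 'I_(\dim {:V})})
  \sum_(J : {ffun 'I_k -> 'I_(\dim {:V})})
    (\prod_(l < k) inv_gram g (I l) (J l)) *
    (a (fun l => tnth (vbasis {:V}) (I l)) *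
     b (fun l => tnth (vbasis {:V}) (J l))).

(* ( * b)(y) = <b, vol(-, y)>, that is
   ( * b)_(j1...jm) = 1/k! b^(i1...ik) vol_(i1...ik j1...jm): for dim V = k + m
   it is the m-form such that a /\ * b = <a, b> vol for every k-form a. *)
Definition hodge (g : {dot V for idfun}) k m (vol : ('I_(k + m) -> V) -> R)
    (b : ('I_k -> V) -> R) : ('I_m -> V) -> R :=
  fun y => form_inner g b (fun x => vol (vcat x y)).

Definition orthonormal_frame (g : {dot V for idfun}) k (e : 'I_k -> V) : Prop :=
  forall i j, g (e i) (e j) = (i == j)%:R.

(* For k = dim V, this singles out the two volume forms of g, one for each
   orientation of V. *)
Definition is_volume_form (g : {dot V for idfun}) k (vol : ('I_k -> V) -> R) :
    Prop :=
  is_form vol /\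
  (forall e : 'I_k -> V, orthonormal_frame g e -> `|vol e| = 1).

Definition is_g2_structure (phi : ('I_3 -> V) -> R) : Prop :=
  is_form phi /\
  (forall v : V, v != 0 ->
     exists x : 'I_7 -> V,
       wedge (wedge (interior v phi) (interior v phi)) phi x != 0).

(* g and vol are the metric and the volume form determined by phi. *)
Definition g2_induces (phi : ('I_3 -> V) -> R) (g : {dot V for idfun})
    (vol : ('I_7 -> V) -> R) : Prop :=
  is_volume_form g vol /\
  (forall (v w : V) (x : 'I_7 -> V),
     g v w * vol x =
     6^-1 * wedge (wedge (interior v phi) (interior w phi)) phi x).

Definition g2_metric (phi : ('I_3 -> V) -> R) (g : {dot V for idfun}) : Prop :=
  exists vol : ('I_7 -> V) -> R, g2_induces phi g vol.

End ExteriorAlgebra.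

Section LieAlgebra.
Variables (R : realType) (n : vectType R) (br : {bilinear n -> n -> n}).

Definition is_lie_bracket : Prop :=
  (forall x : n, br x x = 0) /\
  (forall x y z : n, br x (br y z) + br y (br z x) + br z (br x y) = 0).

(* The span of the brackets of all pairs of vectors, by bilinearity. *)
Definition derived_algebra : {vspace n} :=
  <<[seq br x y | x <- vbasis {:n}, y <- vbasis {:n}]>>%VS.

Definition is_central (x : n) : Prop := forall y : n, br x y = 0.

Definition is_two_step_nilpotent : Prop :=
  (exists x y : n, br x y != 0) /\
  (forall x : n, x \in derived_algebra -> is_central x).

Definition is_ideal (I : {vspace n}) : Prop :=
  forall x y : n, y \in I -> br x y \in I.

Definition is_reducible : Prop :=
  exists I J : {vspace n},
    [/\ is_ideal I /\ is_ideal J, I != 0%VS /\ J != 0%VS,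
        (I + J)%VS = {:n}%VS & (I :&: J)%VS = 0%VS].

Definition is_irreducible : Prop := ~ is_reducible.

(* The Chevalley-Eilenberg differential
   (d a)(x_0, ..., x_(k+1)) = sum_(i < j) (-1)^(i + j)
      a([x_i, x_j], x_0, ..^x_i.., ..^x_j.., x_(k+1)),
   with j written as lift i j', i.e. j = j' + 1 for i <= j'. It is the graded
   derivation extending d a (x, y) = - a [x, y] on 1-forms. *)
Definition ce_diff k (a : ('I_k.+1 -> n) -> R) : ('I_k.+2 -> n) -> R :=
  fun x => \sum_(i < k.+2) \sum_(j < k.+1 | (i <= j)%N)
    (-1) ^+ (i + j.+1) *
    a (vcons (br (x i) (x (lift i j))) (fun l => x (lift i (lift j l)))).

Definition is_coclosed_g2 (phi : ('I_3 -> n) -> R) : Prop :=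
  is_g2_structure phi /\
  (exists (g : {dot n for idfun}) (vol : ('I_7 -> n) -> R),
     g2_induces phi g vol /\
     (forall x : 'I_5 -> n, ce_diff (@hodge R n g 3 4 vol phi) x = 0)).

End LieAlgebra.

(* Main.v *)
(* Let D be the derived algebra, w_z = g([-, -], z) and psi the Hodge dual of phi.

   If dim D = 2 and D is spanned by orthonormal z_1, z_2, then contracting
   d psi = 0 with z_1 and z_2 gives w_(z_i) /\ tau = 0, where
   tau = psi(z_1, z_2, -, -) is a 2-form on the 5-dimensional space orthogonal to D.
   By skew-symmetry tau has a kernel vector v, and by nondegeneracy of phi it has
   rank 4; hence w_(z_i)(v, -) = 0, so v is central and the algebra splits off Rv.

   Conversely dim D <= 3 always. If D is contained in a 3-dimensional central
   subspace Z (dim D = 3, or dim D = 2 and reducible), take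
   phi = e^012 + sum_p e^p /\ s_p with e_0, e_1, e_2 in Z and s_p an orthogonal
   triple of 2-forms, of equal norm and of the same duality type, on the orthogonal
   complement of Z; then d psi = 0 says that the matrix <w_(e_p), s_q> is symmetric.
   If D is a line spanned by e_0, take
   phi = e^0 /\ s + Re Psi with s = e^12 + e^34 + e^56; then d psi = 0 says that
   w_(e_0) is of type (1,1). In both cases the condition is the vanishing of the
   first variation, under rotations of the frame, of a continuous function on a
   compact set of orthonormal frames, so that it holds at a maximum. *)

From mathcomp Require Import all_boot all_order all_fingroup all_algebra.
From mathcomp Require Import reals boolp classical_sets set_interval topology normedtype derive.
From mathcomp Require Import ring lra zify.
Require Import Defs.

Set Implicit Arguments.
Unset Strict Implicit.
Unset Printing Implicit Defensive.

Import Order.TTheory GRing.Theory Num.Theory.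
Local Open Scope ring_scope.

(** * Alternating forms *)

(** One 3-form serves both existence cases: e^012 + e^034 + e^056 + e^135 - e^146 - e^236 - e^245
    reads as e^012 + sum_p e^p /\ s_p and also as e^0 /\ s + Re Psi, where Psi is the product of e^1
    + i e^2, e^3 + i e^4 and e^5 + i e^6. Only the pattern of vanishing structure constants changes
    between the two. The obstacle is size: a wedge product of degree 7 is a sum over 5040
    permutations. Products of coordinate functions antisymmetrize to determinants, hence to signs of
    index lists, so the metric of the model and its coclosedness reduce to identities between
    integers, or between integer combinations of structure constants, which are settled by
    evaluation. No derivative is taken at the maximum. Each rotation used moves the frame in one
    plane, along which the functional is c a + s b + d with c^2 + s^2 = 1, and maximality at c = 1,
    s = 0 forces b = 0. *)

Section Multilinear.
Variables (R : realType) (V : vectType R).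
Implicit Types (u v : V).

Lemma scalar0 (f : V -> R) : scalar f -> f 0 = 0.
Proof. by move=> sf; have /= := sf (-1) 0 0; rewrite scaler0 addr0 mulN1r addNr. Qed.

Lemma scalar_scale (f : V -> R) c u : scalar f -> f (c *: u) = c * f u.
Proof. by move=> sf; have /= := sf c u 0; rewrite addr0 scalar0 // addr0. Qed.

Lemma scalar_sum (f : V -> R) : scalar f ->
  forall (I : Type) (r : seq I) (P : pred I) F,
  f (\sum_(j <- r | P j) F j) = \sum_(j <- r | P j) f (F j).
Proof.
move=> sf I r P F; elim/big_rec2: _ => [|j y u _ <-]; first exact: scalar0.
by have /= := sf 1 (F j) u; rewrite scale1r mul1r.
Qed.

Definition multilinear k (a : ('I_k -> V) -> R) : Prop :=
  forall (x : 'I_k -> V) (i : 'I_k),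
    scalar (fun u : V => a (@dfwith _ (fun=> V) x i u)).

Lemma dfwith_comp k m (x : 'I_k -> V) (h : 'I_m -> 'I_k) (i : 'I_m) u :
  injective h ->
  (fun j => @dfwith _ (fun=> V) x (h i) u (h j)) =
  @dfwith _ (fun=> V) (fun j => x (h j)) i u.
Proof.
move=> hI; apply: funext => j; case: (eqVneq i j) => [<-|nij].
  by rewrite !dfwith_in.
by rewrite !dfwith_out // (inj_eq hI).
Qed.

Lemma dfwith_comp_out k m (x : 'I_k -> V) (h : 'I_m -> 'I_k) i u :
  (forall j, h j != i) ->
  (fun j => @dfwith _ (fun=> V) x i u (h j)) = (fun j => x (h j)).
Proof. by move=> hi; apply: funext => j; rewrite dfwith_out // eq_sym. Qed.

Lemma multilinear_sum k (a : ('I_k -> V) -> R) :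
  multilinear a -> forall (x : 'I_k -> V) i (I : Type) (r : seq I) (P : pred I) F,
  a (@dfwith _ (fun=> V) x i (\sum_(j <- r | P j) F j)) =
  \sum_(j <- r | P j) a (@dfwith _ (fun=> V) x i (F j)).
Proof. by move=> ma x i I r P F; apply: (scalar_sum (ma x i)). Qed.

Lemma multilinearZ k (a : ('I_k -> V) -> R) :
  multilinear a -> forall (x : 'I_k -> V) i c u,
  a (@dfwith _ (fun=> V) x i (c *: u)) = c * a (@dfwith _ (fun=> V) x i u).
Proof. by move=> ma x i c u; apply: (scalar_scale _ _ (ma x i)). Qed.

Lemma vcons_dfwith0 k (y : 'I_k -> V) u v :
  vcons u y = @dfwith _ (fun=> V) (vcons v y) ord0 u.
Proof.
apply: funext => j; case: (unliftP ord0 j) => [j'|] ->.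
  by rewrite dfwith_out ?neq_lift // /vcons liftK.
by rewrite dfwith_in /vcons unlift_none.
Qed.

Lemma vcons_dfwith k (y : 'I_k -> V) v i u :
  vcons v (@dfwith _ (fun=> V) y i u) =
  @dfwith _ (fun=> V) (vcons v y) (lift ord0 i) u.
Proof.
apply: funext => j; case: (unliftP ord0 j) => [j'|] ->; last first.
  by rewrite dfwith_out 1?eq_sym ?neq_lift // /vcons unlift_none.
rewrite /vcons liftK; case: (eqVneq i j') => [<-|nij]; first by rewrite !dfwith_in.
by rewrite !dfwith_out ?(inj_eq lift_inj) // liftK.
Qed.

Lemma multilinear_vcons k (a : ('I_k.+1 -> V) -> R) v :
  multilinear a -> multilinear (fun y => a (vcons v y)).
Proof. by move=> ma x i c u w /=; rewrite !vcons_dfwith; apply: ma. Qed.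

Lemma scalar_vcons k (a : ('I_k.+1 -> V) -> R) y :
  multilinear a -> scalar (fun v => a (vcons v y)).
Proof.
move=> ma c u w /=.
rewrite (vcons_dfwith0 y (_ + _) 0) (vcons_dfwith0 y u 0) (vcons_dfwith0 y w 0).
exact: ma.
Qed.

Lemma vcons_eta k (x : 'I_k.+1 -> V) :
  x = vcons (x ord0) (fun j => x (lift ord0 j)).
Proof.
by apply: funext => j; rewrite /vcons; case: (unliftP ord0 j) => [j'|] ->.
Qed.

Lemma sum_ffun_recl (T : finType) k (G : ('I_k.+1 -> T) -> R) :
  \sum_(f : {ffun 'I_k.+1 -> T}) G f =
  \sum_(j : T) \sum_(f : {ffun 'I_k -> T})
     G (fun i => if unlift ord0 i is Some i' then f i' else j).
Proof.
rewrite pair_big /=.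
pose h (p : T * {ffun 'I_k -> T}) : {ffun 'I_k.+1 -> T} :=
  [ffun i => if unlift ord0 i is Some i' then p.2 i' else p.1].
rewrite (reindex h); last first.
  exists (fun f : {ffun 'I_k.+1 -> T} => (f ord0, [ffun i => f (lift ord0 i)])).
    move=> [j f] _; rewrite /h /= !ffunE unlift_none; congr (_, _).
    by apply/ffunP => i; rewrite !ffunE liftK.
  move=> f _; apply/ffunP => i; rewrite !ffunE /=.
  by case: (unliftP ord0 i) => [i'|] ->; rewrite ?ffunE.
by apply: eq_bigr => p _; congr G; apply: funext => i; rewrite ffunE.
Qed.

Lemma multilinear_expand k m (a : ('I_k -> V) -> R) (c : 'I_k -> 'I_m -> R)
    (e : 'I_m -> V) : multilinear a ->
  a (fun i => \sum_j c i j *: e j) =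
  \sum_(f : {ffun 'I_k -> 'I_m}) (\prod_i c i (f i)) * a (fun i => e (f i)).
Proof.
elim: k a c => [|k IH] a c ma.
  rewrite (big_pred1 (ffun0 (card_ord 0))) => [|f]; last first.
    by apply/esym/eqP/ffunP; case.
  by rewrite big_ord0 mul1r; congr a; apply: funext; case.
rewrite (sum_ffun_recl (fun f => (\prod_i c i (f i)) * a (fun i => e (f i)))).
rewrite [X in a X]vcons_eta (vcons_dfwith0 _ _ 0) multilinear_sum //.
apply: eq_bigr => j _; rewrite multilinearZ // -vcons_dfwith0.
rewrite (IH (fun y => a (vcons (e j) y)) (fun i => c (lift ord0 i)));
  last exact: multilinear_vcons.
rewrite mulr_sumr; apply: eq_bigr => f _; rewrite mulrA; congr (_ * _).
  rewrite big_ord_recl unlift_none; congr (_ * _).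
  by apply: eq_bigr => i _; rewrite liftK.
congr a; rewrite [RHS]vcons_eta unlift_none; congr vcons.
by apply: funext => i; rewrite liftK.
Qed.

Lemma is_form_multilinear k (a : ('I_k -> V) -> R) : is_form a -> multilinear a.
Proof. by case. Qed.

Lemma form_noninj k m (a : ('I_k -> V) -> R) (e : 'I_m -> V) (f : 'I_k -> 'I_m) :
  is_form a -> ~~ injectiveb f -> a (fun i => e (f i)) = 0.
Proof. by move=> [_ alt] /injectivePn[i [j nij fij]]; apply: (alt _ i j); rewrite ?fij. Qed.

Lemma form_tperm k (a : ('I_k -> V) -> R) (x : 'I_k -> V) i j :
  is_form a -> i != j -> a (fun l => x (tperm i j l)) = - a x.
Proof.
move=> [ma alt] nij.
pose d u v := @dfwith _ (fun=> V) (@dfwith _ (fun=> V) x i u) j v.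
have dx u v l : d u v l = if l == j then v else if l == i then u else x l.
  rewrite /d; case: (eqVneq l j) => [->|nlj]; first by rewrite dfwith_in.
  rewrite dfwith_out 1?eq_sym //; case: (eqVneq l i) => [->|nli].
    by rewrite dfwith_in.
  by rewrite dfwith_out 1?eq_sym.
have d0 u : a (d u u) = 0.
  by apply: (alt _ i j) => //; rewrite !dx !eqxx (negPf nij).
have dDr u v w : a (d u (v + w)) = a (d u v) + a (d u w).
  by have /= := ma (@dfwith _ (fun=> V) x i u) j 1 v w; rewrite scale1r mul1r.
have dC u v : d u v = @dfwith _ (fun=> V) (@dfwith _ (fun=> V) x j v) i u.
  apply: funext => l; rewrite dx; case: (eqVneq l j) => [->|nlj].
    by rewrite dfwith_out // dfwith_in.
  case: (eqVneq l i) => [->|nli]; first by rewrite dfwith_in.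
  by rewrite !dfwith_out // eq_sym.
have dDl u v w : a (d (u + v) w) = a (d u w) + a (d v w).
  rewrite !dC.
  by have /= := ma (@dfwith _ (fun=> V) x j w) i 1 u v; rewrite scale1r mul1r.
have := d0 (x i + x j); rewrite dDl !dDr !d0 add0r addr0 => E.
have -> : a x = a (d (x i) (x j)).
  congr a; apply: funext => l; rewrite dx.
  case: (eqVneq l j) => [->//|_]; case: (eqVneq l i) => [->//|//].
have -> : (fun l => x (tperm i j l)) = d (x j) (x i).
  apply: funext => l; rewrite dx.
  case: tpermP => [->|->|/eqP/negPf ni /eqP/negPf nj].
  - by rewrite (negPf nij) eqxx.
  - by rewrite eqxx.
  - by rewrite nj ni.
by apply/eqP; rewrite -addr_eq0 addrC; apply/eqP.
Qed.

Lemma form_perm k (a : ('I_k -> V) -> R) (x : 'I_k -> V) (s : 'S_k) :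
  is_form a -> a (fun i => x (s i)) = (-1) ^+ s * a x.
Proof.
move=> fa; case: (prod_tpermP s) => ts -> {s}; elim: ts x => [|t ts IH] x /=.
  rewrite big_nil odd_perm1 mul1r => _; congr a; apply: funext => i.
  by rewrite perm1.
move=> /andP[dt dts]; rewrite big_cons odd_permM odd_tperm; move: (dt) => /= -> /=.
rewrite signrN mulNr -(IH x) // -(form_tperm _ fa dt).
by congr a; apply: funext => i; rewrite permM.
Qed.

(** Expanding by multilinearity gives a sum over all maps of indices; alternation kills the
    non-injective ones, and what remains is the Leibniz formula for the determinant. *)
Lemma top_form k (a : ('I_k -> V) -> R) (e : 'I_k -> V) (M : 'M[R]_k) :
  is_form a -> a (fun i => \sum_j M i j *: e j) = \det M * a e.
Proof.
move=> fa; rewrite multilinear_expand; last exact: is_form_multilinear.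
rewrite (bigID (fun f : {ffun 'I_k -> 'I_k} => injectiveb f)) /=.
rewrite [X in _ + X]big1 ?addr0 => [|f /(form_noninj e fa) ->]; last by rewrite mulr0.
rewrite (reindex (@pval _)) /=; last first.
  pose in_Sn := insubd (1%g : 'S_k).
  by exists in_Sn => /= f Uf; first apply: val_inj; apply: insubdK.
rewrite mulr_suml; apply: eq_big => /= [s | s _]; rewrite ?(valP s) //.
rewrite -mulrA mulrCA; congr (_ * _).
  by apply: eq_bigr => i _; rewrite pvalE.
rewrite -form_perm //; congr a; apply: funext => i; congr e.
by rewrite pvalE.
Qed.

(** Antisymmetrization without the factor 1/k!. The wedge product, the frame volume and the
    differential of a 4-form are each written as a multiple of such a sum. *)
Definition altsum k (F : ('I_k -> V) -> R) : ('I_k -> V) -> R :=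
  fun x => \sum_(s : 'S_k) (-1) ^+ s * F (fun i => x (s i)).

Lemma altsum_perm k (F : ('I_k -> V) -> R) (t : 'S_k) x :
  altsum F (fun i => x (t i)) = (-1) ^+ t * altsum F x.
Proof.
rewrite /altsum (reindex_inj (mulIg t^-1%g)) /= mulr_sumr.
apply: eq_bigr => s _; rewrite odd_permM odd_permV signr_addb.
rewrite [X in X * _]mulrC -mulrA; congr (_ * (_ * _)).
by congr F; apply: funext => i; rewrite permM permKV.
Qed.

Lemma altsum_form k (F : ('I_k -> V) -> R) : multilinear F -> is_form (altsum F).
Proof.
move=> mF; split=> [x i c u v|x i j nij xij] /=.
  rewrite /altsum mulr_sumr -big_split /=; apply: eq_bigr => s _.
  have E w : (fun j => @dfwith _ (fun=> V) x i w (s j)) =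
      @dfwith _ (fun=> V) (fun j => x (s j)) (s^-1%g i) w.
    by rewrite -{1}[i](permKV s) dfwith_comp //; apply: perm_inj.
  by rewrite !E mF mulrDr !mulrA [_ * c]mulrC.
have := altsum_perm F (tperm i j) x.
rewrite odd_tperm nij expr1 mulN1r.
have -> : (fun l => x (tperm i j l)) = x.
  by apply: funext => l; case: tpermP => [->|->|].
move=> /eqP; rewrite -addr_eq0 -mulr2n mulrn_eq0 /= => /eqP //.
Qed.

Lemma form_antisym_sum k (a : ('I_k -> V) -> R) x :
  is_form a -> altsum a x = k`!%:R * a x.
Proof.
move=> fa; rewrite /altsum (eq_bigr (fun=> a x)) => [|s _].
  by rewrite sumr_const cardE /= -cardE card_Sn -[in LHS]mulr_natl.
by rewrite form_perm // mulrA -expr2 sqrr_sign mul1r.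
Qed.

End Multilinear.

(** * Levi-Civita symbols and triple wedge products *)

Section LeviCivita.

(* To be used with [n = size s] and entries [< n]; removing the head [x] renumbers
   the remaining values by [unbump x], as in the Laplace expansion along row 0. *)
Fixpoint levi_civita (n : nat) (s : seq nat) : int :=
  if (n, s) is (n'.+1, x :: s') then
    if x \in s' then 0
    else (-1) ^+ x * levi_civita n' (map (unbump x) s')
  else 1.

Variable R : comNzRingType.

(** Links the recursive sign, which can be evaluated, to a determinant, which is what forms
    produce. *)
Lemma det_levi_civita n (s : seq nat) : size s = n -> all (ltn^~ n) s ->
  \det (\matrix_(i < n, j < n) (nth n s i == j)%:R : 'M[R]_n) =
  (levi_civita n s)%:~R.
Proof.
elim: n s => [|n IH] [|x s] //= => [_ _|[ss] /andP[xn als]].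
  by rewrite det_mx00.
(* A repeated head makes row 0 equal to a later row; otherwise row 0 has a single 1, in column x. *)
case: ifP => [xs|/negbT xs].
  have [i si E] : exists2 i, (i < n)%N & nth n.+1 s i = x.
    by exists (index x s); rewrite ?nth_index // -ss index_mem.
  apply: (@determinant_alternate _ _ _ ord0 (lift ord0 (Ordinal si))) => // j.
  by rewrite !mxE /= E.
rewrite (expand_det_row _ ord0) (bigD1 (Ordinal xn)) //= big1 ?addr0; last first.
  by move=> j /negPf nj; rewrite mxE /= eq_sym -val_eqE /= in nj *; rewrite nj mul0r.
rewrite mxE eqxx mul1r /cofactor add0n rmorphM rmorphXn rmorphN1 /= -IH.
- congr (_ * \det _); apply/matrixP => i j; rewrite !mxE /=; congr (_%:R).
  have si : (i < size s)%N by rewrite ss.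
  rewrite (nth_map n.+1) //; set y := nth _ _ _.
  have yx : y != x by apply: contraNneq xs => <-; apply: mem_nth.
  have yE : y = bump x (unbump x y) by rewrite unbumpKcond (negPf yx).
  by rewrite [in LHS]yE (can_eq (@bumpK x)).
- by rewrite size_map.
- apply/allP => _ /mapP[y ys ->]; have /allP/(_ y ys) /= yn := als.
  have yx : y != x by apply: contraNneq xs => <-.
  by rewrite /unbump; case: (ltnP x y) => /= xy; lia.
Qed.

End LeviCivita.

Section Wedge.
Variables (R : realType) (V : vectType R).

Lemma pair_perm_inj p q (t : 'S_p) :
  injective (fun i : 'I_(p + q) =>
    match split i with inl j => lshift q (t j) | inr j => rshift p j end).
Proof.
move=> i i'; case: (split_ordP i) => j ->; case: (split_ordP i') => j' ->.
- by move=> /lshift_inj/perm_inj ->.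
- by move=> /eqP; rewrite eq_lrshift.
- by move=> /eqP; rewrite eq_rlshift.
- by move=> /rshift_inj ->.
Qed.

Definition extend_perm p q (t : 'S_p) : 'S_(p + q) := perm (@pair_perm_inj p q t).

Lemma extend_perml p q (t : 'S_p) j : extend_perm q t (lshift q j) = lshift q (t j).
Proof. by rewrite permE; case: split_ordP => k /eqP; rewrite ?eq_lrshift // => /eqP/lshift_inj ->. Qed.

Lemma extend_permr p q (t : 'S_p) j : extend_perm q t (rshift p j) = rshift p j.
Proof. by rewrite permE; case: split_ordP => k /eqP; rewrite ?eq_rlshift // => /eqP/rshift_inj ->. Qed.

(** The matrix of the extended permutation is block diagonal, so its determinant is that of t. *)
Lemma sign_extend_perm p q (t : 'S_p) : (-1) ^+ extend_perm q t = (-1) ^+ t :> R.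
Proof.
rewrite -!det_perm; have -> : perm_mx (extend_perm q t) =
    block_mx (perm_mx t) 0 0 1%:M :> 'M[R]_(p + q).
  apply/matrixP => i j; case: (split_ordP i) => i' ->; case: (split_ordP j) => j' ->.
  - by rewrite block_mxEul !mxE extend_perml (inj_eq (@lshift_inj _ _)).
  - by rewrite block_mxEur !mxE extend_perml eq_lrshift.
  - by rewrite block_mxEdl !mxE extend_permr eq_rlshift.
  - by rewrite block_mxEdr !mxE extend_permr (inj_eq (@rshift_inj _ _)).
by rewrite det_ublock det1 mulr1.
Qed.

Lemma wedge_altsum p q (a : ('I_p -> V) -> R) (b : ('I_q -> V) -> R) :
  wedge a b = fun x => ((p`! * q`!)%N%:R)^-1 *
    altsum (fun y => a (fun i => y (lshift q i)) * b (fun i => y (rshift p i))) x.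
Proof. by []. Qed.

(* Expanding the inner wedge product gives one term per t in S_(p+q); reindexing
   the outer sum by t (+) 1 shows that they are all equal. *)
Lemma wedge_wedge p q r (a : ('I_p -> V) -> R) (b : ('I_q -> V) -> R)
    (c : ('I_r -> V) -> R) x :
  wedge (wedge a b) c x = ((p`! * q`! * r`!)%N%:R)^-1 *
    altsum (fun y => a (fun i => y (lshift r (lshift q i))) *
                     b (fun i => y (lshift r (rshift p i))) *
                     c (fun i => y (rshift (p + q) i))) x.
Proof.
set G := (X in altsum X).
have Gperm (t : 'S_(p + q)) : \sum_(s : 'S_(p + q + r)) (-1) ^+ s *
    ((-1) ^+ t * G (fun i => x (s (extend_perm r t i)))) = altsum G x.
  rewrite (reindex_inj (mulgI (extend_perm r t)^-1%g)) /=.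
  apply: eq_bigr => s _; rewrite odd_permM odd_permV signr_addb sign_extend_perm.
  rewrite -mulrA mulrCA [X in _ * X]mulrA -expr2 sqrr_sign mul1r; congr (_ * _).
  by congr G; apply: funext => i; rewrite permM permK.
transitivity ((((p + q)`! * r`!)%N%:R)^-1 * ((p`! * q`!)%N%:R)^-1 *
  \sum_(t : 'S_(p + q)) altsum G x).
  rewrite wedge_altsum /altsum -mulrA; congr (_ * _).
  rewrite -[in RHS](eq_bigr _ (fun t _ => Gperm t)) exchange_big mulr_sumr.
  apply: eq_bigr => s _; rewrite -mulr_sumr [RHS]mulrCA; congr (_ * _).
  rewrite /wedge -mulrA; congr (_ * _); rewrite mulr_suml.
  apply: eq_bigr => t _; rewrite -mulrA; congr (_ * _); congr (_ * _ * _).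
  - by congr a; apply: funext => i; rewrite extend_perml.
  - by congr b; apply: funext => i; rewrite extend_perml.
  - by congr c; apply: funext => i; rewrite extend_permr.
rewrite sumr_const cardE /= -cardE card_Sn -[altsum G x *+ _]mulr_natl mulrA; congr (_ * _).
rewrite !natrM; field; rewrite ?pnatr_eq0 -?lt0n ?fact_gt0 //.
Qed.

Lemma altsum_sum k (I : Type) (r : seq I) (F : I -> ('I_k -> V) -> R) x :
  altsum (fun y => \sum_(i <- r) F i y) x = \sum_(i <- r) altsum (F i) x.
Proof.
rewrite /altsum exchange_big; apply: eq_bigr => s _; exact: mulr_sumr.
Qed.

Lemma altsumZ k c (F : ('I_k -> V) -> R) x :
  altsum (fun y => c * F y) x = c * altsum F x.
Proof. by rewrite /altsum mulr_sumr; apply: eq_bigr => s _; rewrite mulrCA. Qed.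

Lemma altsum_prod k (c : 'I_k -> V -> R) x :
  altsum (fun y => \prod_i c i (y i)) x = \det (\matrix_(i, j) c i (x j)).
Proof. by apply: eq_bigr => s _; congr (_ * _); apply: eq_bigr => i _; rewrite mxE. Qed.

End Wedge.

(** * Orthonormal frames and the Hodge operator *)

Section Metric.
Variables (R : realType) (V : vectType R) (g : {dot V for idfun}).
Implicit Types (u v w : V).

Lemma dotC u v : g u v = g v u.
Proof. by rewrite hermC /= expr0 mul1r. Qed.

Lemma dotDl u v w : g (u + v) w = g u w + g v w. Proof. exact: linearDl. Qed.
Lemma dotDr u v w : g w (u + v) = g w u + g w v. Proof. exact: linearDr. Qed.
Lemma dotZl c u w : g (c *: u) w = c * g u w. Proof. exact: linearZl_LR. Qed.
Lemma dotZr c u w : g w (c *: u) = c * g w u. Proof. exact: linearZr_LR. Qed.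
Lemma dot0l w : g 0 w = 0. Proof. exact: linear0l. Qed.
Lemma dotNl u w : g (- u) w = - g u w. Proof. exact: linearNl. Qed.
Lemma dot_suml (I : Type) (r : seq I) (P : pred I) F w :
  g (\sum_(i <- r | P i) F i) w = \sum_(i <- r | P i) g (F i) w.
Proof. exact: linear_sumlz. Qed.
Lemma dot_sumr (I : Type) (r : seq I) (P : pred I) F w :
  g w (\sum_(i <- r | P i) F i) = \sum_(i <- r | P i) g w (F i).
Proof. exact: linear_sumr. Qed.

Lemma dot_gt0 u : u != 0 -> 0 < g u u.
Proof. exact: neq0_dnorm_gt0. Qed.

Lemma dot_normalize u : u != 0 ->
  g ((Num.sqrt (g u u))^-1 *: u) ((Num.sqrt (g u u))^-1 *: u) = 1.
Proof.
move=> /dot_gt0 gu; rewrite dotZl dotZr mulrA -expr2 exprVn sqr_sqrtr ?mulVf ?gt_eqF //.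
exact: ltW.
Qed.

(** Lists let a basis of a subspace be extended one vector at a time; [orthonormal_frame] is the
    version of fixed length on which forms are evaluated. *)
Definition orthonormal_seq (s : seq V) : Prop :=
  forall i j, (i < size s)%N -> (j < size s)%N -> g s`_i s`_j = (i == j)%:R.

Lemma orthonormal_free s : orthonormal_seq s -> free s.
Proof.
move=> os; suff: free (in_tuple s) by [].
apply/freeP => c E i.
have := congr1 (g^~ s`_i) E; rewrite /= dot0l dot_suml.
rewrite (bigD1 i) //= big1 => [|j /negPf ji].
  by rewrite addr0 dotZl os // eqxx mulr1.
by rewrite dotZl os // val_eqE ji mulr0.
Qed.

Lemma orthonormal_span s x : orthonormal_seq s -> x \in <<s>>%VS ->
  x = \sum_(i < size s) g x s`_i *: s`_i.
Proof.
move=> os /(coord_span (X := in_tuple s)) E; rewrite {1}E.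
apply: eq_bigr => i _; congr (_ *: _).
rewrite {2}E dot_suml (bigD1 i) //= big1 => [|j /negPf ji].
  by rewrite addr0 dotZl os // eqxx mulr1.
by rewrite dotZl os // val_eqE ji mulr0.
Qed.

Lemma orthonormal_spans s (W : {vspace V}) : orthonormal_seq s -> {subset s <= W} ->
  size s = \dim W -> <<s>>%VS = W.
Proof.
move=> os sW ss; apply/eqP; rewrite eqEdim -ss; apply/andP; split; first exact/span_subvP.
by move/eqP: (orthonormal_free os) => ->.
Qed.

(** One Gram-Schmidt step: s is too short to span W, and a vector of W outside its span is projected
    orthogonally to s and normalized. *)
Lemma orthonormal_rcons s (W : {vspace V}) : orthonormal_seq s -> {subset s <= W} ->
  (size s < \dim W)%N -> exists2 u, u \in W & orthonormal_seq (rcons s u).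
Proof.
move=> os sW sltW.
have /subvPn[w wW wns] : ~~ (W <= <<s>>)%VS.
  by apply: contraL sltW => /dimvS le; rewrite -leqNgt (leq_trans le (dim_span _)).
pose y := w - \sum_(i < size s) g w s`_i *: s`_i.
have y0 : y != 0.
  apply: contraNneq wns => /eqP; rewrite subr_eq0 => /eqP ->.
  by apply: memv_suml => i _; apply/memvZ/memv_span/mem_nth.
have ys j : (j < size s)%N -> g y s`_j = 0.
  move=> js; rewrite dotDl dotNl dot_suml (bigD1 (Ordinal js)) //= big1 => [|i ij].
    by rewrite addr0 dotZl os // eqxx mulr1 subrr.
  have /negPf ij' : (i : nat) != j := ij.
  by rewrite dotZl os // ij' mulr0.
have yW : y \in W.
  by rewrite memvB // memv_suml // => i _; apply/memvZ/sW/mem_nth.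
pose c := (Num.sqrt (g y y))^-1.
exists (c *: y); first exact: memvZ.
move=> i j; rewrite size_rcons !nth_rcons !ltnS => li lj.
have cyy : g (c *: y) (c *: y) = 1 by exact: dot_normalize.
case: (ltngtP i (size s)) li => [si|//|iE] _; case: (ltngtP j (size s)) lj => [sj|//|jE] _.
- exact: os.
- by rewrite dotC dotZl ys // mulr0 jE (ltn_eqF si).
- by rewrite dotZl ys // mulr0 iE (gtn_eqF sj).
- by rewrite cyy iE jE eqxx.
Qed.

Lemma orthonormal_extend s (W : {vspace V}) : orthonormal_seq s -> {subset s <= W} ->
  exists s', [/\ orthonormal_seq (s ++ s'), {subset s' <= W} & size (s ++ s') = \dim W].
Proof.
move=> os sW; have [m lem] := ubnP (\dim W - size s).
elim: m s os sW lem => // m IH s os sW lem.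
have /orthonormal_free fs := os.
have : (size s <= \dim W)%N.
  by move/eqP: (fs) => <-; apply/dimvS/span_subvP.
rewrite leq_eqVlt => /orP[/eqP E|lt]; first by exists [::]; rewrite cats0.
have [u uW ou] := orthonormal_rcons os sW lt.
have [||s' []] := IH _ ou.
- by move=> x; rewrite mem_rcons inE => /predU1P[->|/sW].
- by rewrite size_rcons; lia.
rewrite cat_rcons => os' s'W E; exists (u :: s'); split => //.
by move=> x; rewrite inE => /predU1P[->|/s'W].
Qed.

Lemma orthonormal_basis (W : {vspace V}) :
  exists s, [/\ orthonormal_seq s, {subset s <= W} & size s = \dim W].
Proof.
have [|//|s [os sW ss]] := @orthonormal_extend [::] W; first by [].
by exists s.
Qed.

Lemma orthonormal_frame_of (n : nat) s : orthonormal_seq s -> \dim {:V} = n ->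
  exists2 e : 'I_n -> V, orthonormal_frame g e &
    forall i : 'I_n, (i < size s)%N -> e i = s`_i.
Proof.
move=> os dn; have [|s' [os' _ E]] := orthonormal_extend (W := fullv) os.
  by move=> x _; rewrite memvf.
rewrite dn in E.
exists (fun i => (s ++ s')`_i) => [i j|i si]; first by rewrite os' ?E.
by rewrite nth_cat si.
Qed.

Lemma orthonormal_codom n (e : 'I_n -> V) :
  orthonormal_frame g e -> orthonormal_seq (codom e).
Proof.
move=> oe i j; rewrite size_codom card_ord => li lj.
have E k (lk : (k < n)%N) : (codom e)`_k = e (Ordinal lk).
  rewrite codomE (nth_map (Ordinal lk)) ?size_enum_ord //; congr e.
  by apply: val_inj; rewrite /= nth_enum_ord.
by rewrite (E _ li) (E _ lj) oe.
Qed.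

Lemma frame_expand n (e : 'I_n -> V) x : \dim {:V} = n ->
  orthonormal_frame g e -> x = \sum_j g x (e j) *: e j.
Proof.
move=> dn /orthonormal_codom oc.
have E : <<codom e>>%VS = fullv.
  apply/eqP; rewrite eqEdim subvf dn.
  by move/eqP: (orthonormal_free oc) => ->; rewrite size_codom card_ord leqnn.
have := @orthonormal_span _ x oc; rewrite E => /(_ (memvf x)) {1}->.
have nthE (k : 'I_n) : (codom e)`_k = e k.
  rewrite codomE (nth_map k) ?size_enum_ord //; congr e.
  by apply: val_inj; rewrite /= nth_enum_ord.
have sz : size (codom e) = n by rewrite size_codom card_ord.
rewrite (reindex (cast_ord (esym sz))) /=; last first.
  by exists (cast_ord sz) => i _; rewrite ?cast_ordK ?cast_ordKV.
by apply: eq_bigr => i _; rewrite nthE.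
Qed.

Lemma frame_parseval n (e : 'I_n -> V) x y : \dim {:V} = n ->
  orthonormal_frame g e -> g x y = \sum_j g x (e j) * g y (e j).
Proof.
move=> dn oe; rewrite {1}(frame_expand x dn oe) dot_suml.
by apply: eq_bigr => j _; rewrite dotZl [g (e j) y]dotC.
Qed.

(** Let P hold the coordinates of the reference basis in the frame. Its Gram matrix is G = P P^T, so
    P^T G^-1 P = 1 and the double sum over multi-indices collapses to its diagonal. *)
Lemma form_inner_frame n (e : 'I_n -> V) k (a b : ('I_k -> V) -> R) :
  \dim {:V} = n -> orthonormal_frame g e -> multilinear a -> multilinear b ->
  form_inner g a b = k`!%:R^-1 *
    \sum_(I : {ffun 'I_k -> 'I_n}) a (fun l => e (I l)) * b (fun l => e (I l)).
Proof.
move=> dn; move: e; rewrite -dn => e oe ma mb; congr (_ * _).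
pose d := \dim {:V}.
pose P : 'M[R]_d := \matrix_(i, p) g (tnth (vbasis {:V}) i) (e p).
have Pu : P \in unitmx.
  pose Q : 'M[R]_d := \matrix_(q, i) coord (vbasis {:V}) i (e q).
  have /mulmx1_unit[] // : Q *m P = 1%:M.
  apply/matrixP => q p; rewrite !mxE -(oe q p).
  rewrite {1}(coord_vbasis (memvf (e q))) dot_suml; apply: eq_bigr => i _.
  by rewrite !mxE dotZl (tnth_nth 0).
have invE : inv_gram g = invmx P^T *m invmx P.
  rewrite /inv_gram; have -> : \matrix_(i, j)
      g (tnth (vbasis {:V}) i) (tnth (vbasis {:V}) j) = P *m P^T.
    apply/matrixP => i j; rewrite !mxE (frame_parseval _ _ erefl oe).
    by apply: eq_bigr => p _; rewrite !mxE.
  have PTu : P^T \in unitmx by rewrite unitmx_tr.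
  have XG : (invmx P^T *m invmx P) *m (P *m P^T) = 1%:M.
    by rewrite mulmxA -(mulmxA _ _ P) mulVmx // mulmx1 mulVmx.
  have Gu : P *m P^T \in unitmx by rewrite unitmx_mul Pu.
  by rewrite -[LHS]mul1mx -XG -(mulmxA (_ *m _) _ (invmx _)) (mulmxV Gu) mulmx1.
have PGP : P^T *m inv_gram g *m P = 1%:M.
  by rewrite invE mulmxA mulmxV ?unitmx_tr // mul1mx mulVmx.
have ex (c : ('I_k -> V) -> R) (I : 'I_k -> 'I_d) : multilinear c ->
    c (fun l => tnth (vbasis {:V}) (I l)) = \sum_(A : {ffun 'I_k -> 'I_d})
      (\prod_l P (I l) (A l)) * c (fun l => e (A l)).
  move=> mc; rewrite -(multilinear_expand (fun l p => P (I l) p) e mc); congr c.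
  apply: funext => l; rewrite [LHS](frame_expand _ erefl oe).
  by apply: eq_bigr => p _; rewrite mxE.
(* After a and b are expanded in the frame, the sum over I and J factors slot by slot into entries
   of P^T G^-1 P. *)
transitivity (\sum_(A : {ffun 'I_k -> 'I_d}) \sum_(B : {ffun 'I_k -> 'I_d})
   (\prod_l ((P^T *m inv_gram g *m P) (A l) (B l))) *
   (a (fun l => e (A l)) * b (fun l => e (B l)))).
  transitivity (\sum_(I : {ffun 'I_k -> 'I_d}) \sum_(J : {ffun 'I_k -> 'I_d})
    \sum_(A : {ffun 'I_k -> 'I_d}) \sum_(B : {ffun 'I_k -> 'I_d})
    (\prod_l (inv_gram g (I l) (J l) * P (I l) (A l) * P (J l) (B l))) *
    (a (fun l => e (A l)) * b (fun l => e (B l)))).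
    apply: eq_bigr => I _; apply: eq_bigr => J _; rewrite !ex // mulr_suml mulr_sumr.
    apply: eq_bigr => A _; rewrite mulr_sumr mulr_sumr; apply: eq_bigr => B _.
    by rewrite !big_split /=; ring.
  rewrite (eq_bigr _ (fun I _ => exchange_big _ _ _ _ _ _)) exchange_big.
  apply: eq_bigr => A _.
  rewrite (eq_bigr _ (fun I _ => exchange_big _ _ _ _ _ _)) exchange_big.
  apply: eq_bigr => B _; under eq_bigr do rewrite -mulr_suml.
  rewrite -mulr_suml; congr (_ * _).
  transitivity (\prod_l \sum_i \sum_j
      (inv_gram g i j * P i (A l) * P j (B l))); last first.
    apply: eq_bigr => l _; rewrite !mxE exchange_big; apply: eq_bigr => j _.
    rewrite !mxE mulr_suml; apply: eq_bigr => i _; rewrite !mxE; ring.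
  rewrite bigA_distr_bigA /=; apply: eq_bigr => I _; exact/esym/bigA_distr_bigA.
apply: eq_bigr => A _; rewrite PGP (bigD1 A) //= [X in _ + X]big1 => [|B nBA].
  by rewrite addr0 big1 ?mul1r // => l _; rewrite mxE eqxx.
have /forallPn[l nl] : ~~ [forall l, A l == B l].
  by apply: contra nBA => /forallP h; apply/eqP/ffunP => l; rewrite (eqP (h l)).
by rewrite (bigD1 l) //= mxE (negPf nl) !mul0r.
Qed.

End Metric.

Section Vcat.
Variables (R : realType) (V : vectType R).

Lemma vcat_dfwithl p q (x : 'I_p -> V) (y : 'I_q -> V) i u :
  vcat (@dfwith _ (fun=> V) x i u) y =
  @dfwith _ (fun=> V) (vcat x y) (lshift q i) u.
Proof.
apply: funext => j; rewrite /vcat; case: (split_ordP j) => j' ->.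
  case: (eqVneq i j') => [->|ne]; first by rewrite !dfwith_in.
  rewrite !dfwith_out ?(inj_eq (@lshift_inj _ _)) //.
  by case: split_ordP => k /eqP; rewrite ?eq_lrshift // => /eqP/lshift_inj ->.
rewrite dfwith_out ?eq_lrshift //.
by case: split_ordP => k /eqP; rewrite ?eq_rlshift // => /eqP/rshift_inj ->.
Qed.

Lemma vcat_dfwithr p q (x : 'I_p -> V) (y : 'I_q -> V) i u :
  vcat x (@dfwith _ (fun=> V) y i u) =
  @dfwith _ (fun=> V) (vcat x y) (rshift p i) u.
Proof.
apply: funext => j; rewrite /vcat; case: (split_ordP j) => j' ->; last first.
  case: (eqVneq i j') => [->|ne]; first by rewrite !dfwith_in.
  rewrite !dfwith_out ?(inj_eq (@rshift_inj _ _)) //.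
  by case: split_ordP => k /eqP; rewrite ?eq_rlshift // => /eqP/rshift_inj ->.
rewrite dfwith_out ?eq_rlshift //.
by case: split_ordP => k /eqP; rewrite ?eq_lrshift // => /eqP/lshift_inj ->.
Qed.

Lemma vcatl p q (x : 'I_p -> V) (y : 'I_q -> V) i : vcat x y (lshift q i) = x i.
Proof. by rewrite /vcat; case: split_ordP => k /eqP; rewrite ?eq_lrshift // => /eqP/lshift_inj ->. Qed.

Lemma vcatr p q (x : 'I_p -> V) (y : 'I_q -> V) i : vcat x y (rshift p i) = y i.
Proof. by rewrite /vcat; case: split_ordP => k /eqP; rewrite ?eq_rlshift // => /eqP/rshift_inj ->. Qed.

Lemma form_vcatl p q (a : ('I_(p + q) -> V) -> R) y :
  is_form a -> is_form (fun x : 'I_p -> V => a (vcat x y)).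
Proof.
move=> [ma alt]; split=> [x i c u v|x i j ij xij] /=.
  by rewrite !vcat_dfwithl; apply: ma.
by apply: (alt _ (lshift q i) (lshift q j)); rewrite ?eq_lshift // !vcatl.
Qed.

Lemma form_vcatr p q (a : ('I_(p + q) -> V) -> R) x :
  is_form a -> is_form (fun y : 'I_q -> V => a (vcat x y)).
Proof.
move=> [ma alt]; split=> [y i c u v|y i j ij yij] /=.
  by rewrite !vcat_dfwithr; apply: ma.
by apply: (alt _ (rshift p i) (rshift p j)); rewrite ?eq_rshift // !vcatr.
Qed.

End Vcat.

Section Hodge.
Variables (R : realType) (V : vectType R) (g : {dot V for idfun}).
Variables (k m : nat) (e : 'I_(k + m) -> V).
Hypotheses (dV : \dim {:V} = (k + m)%N) (oe : orthonormal_frame g e).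
Variables (vol : ('I_(k + m) -> V) -> R) (b : ('I_k -> V) -> R).
Hypotheses (fvol : is_form vol) (fb : is_form b).

Lemma hodge_frame y : hodge g vol b y = k`!%:R^-1 *
  \sum_(I : {ffun 'I_k -> 'I_(k + m)})
     b (fun l => e (I l)) * vol (vcat (fun l => e (I l)) y).
Proof.
by apply: form_inner_frame => //; [case: fb | case: (form_vcatl y fvol)].
Qed.

Lemma hodge_form : is_form (hodge g vol b).
Proof.
have E y : hodge g vol b y = _ := hodge_frame y.
split=> [y i c u v|y i j ij yij] /=.
  rewrite !E mulrCA -mulrDr; congr (_ * _); rewrite mulr_sumr -big_split /=.
  apply: eq_bigr => I _; have [mv _] := form_vcatr (fun l => e (I l)) fvol.
  by rewrite mv; ring.
rewrite E big1 ?mulr0 // => I _; have [_ av] := form_vcatr (fun l => e (I l)) fvol.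
by rewrite (av _ i j) // mulr0.
Qed.

End Hodge.

Section HodgeDual.
Variables (R : realType) (V : vectType R) (g : {dot V for idfun}).
Variables (k m : nat) (e : 'I_(k + m) -> V).
Hypotheses (dV : \dim {:V} = (k + m)%N) (oe : orthonormal_frame g e).
Variables (vol : ('I_(k + m) -> V) -> R) (b : ('I_k -> V) -> R).
Hypotheses (fvol : is_form vol) (fb : is_form b).

(** Only the index maps K o s with s a permutation contribute: any other one repeats an index or
    meets J. The k! survivors are equal, since the sign of s enters both b and vol, and their number
    cancels the factor 1/k!. *)
Lemma hodge_dual (K : 'I_k -> 'I_(k + m)) (J : 'I_m -> 'I_(k + m)) :
  injective K -> injective J -> (forall i j, K i != J j) ->
  hodge g vol b (fun l => e (J l)) =
  b (fun l => e (K l)) * vol (vcat (fun l => e (K l)) (fun l => e (J l))).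
Proof.
move=> Ki Ji KJ; rewrite (hodge_frame dV oe fvol fb).
pose h (s : 'S_k) : {ffun 'I_k -> 'I_(k + m)} := [ffun l => K (s l)].
have hi : injective h.
  move=> s t /ffunP E; apply/permP => l; apply: Ki.
  by have := E l; rewrite !ffunE.
pose P (f : {ffun 'I_k -> 'I_(k + m)}) := f \in codom h.
rewrite (bigID P) /= [X in _ + X]big1 ?addr0; last first.
  move=> f nPf.
  (* [c] enumerates all k + m indices, K first and then J, so an index outside J is some K l'. *)
  pose c (x : 'I_(k + m)) := match split x with inl l => K l | inr l => J l end.
  have ci : injective c.
    move=> x y; rewrite /c; case: (split_ordP x) => x' ->; case: (split_ordP y) => y' ->.
    - by move=> /Ki ->.
    - by move=> /eqP; rewrite (negPf (KJ _ _)).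
    - by move=> /eqP; rewrite eq_sym (negPf (KJ _ _)).
    - by move=> /Ji ->.
  pose d (x : 'I_(k + m)) := match split x with inl l => f l | inr l => J l end.
  case: (boolP (injectiveb d)) => [/injectiveP di|/injectivePn[x [y xy dxy]]]; last first.
    rewrite mulrC [vol _](_ : _ = 0) ?mul0r //; case: fvol => _ /(_ _ x y xy); apply.
    have E z : vcat (fun l => e (f l)) (fun l => e (J l)) z = e (d z).
      by rewrite /vcat /d; case: split.
    by rewrite !E dxy.
  have fl l : exists l', f l = K l'.
    have := f_invF ci (f l); set z := invF ci (f l).
    rewrite /c; case: split => l' E; first by exists l'.
    have := @di (lshift m l) (rshift k l'); rewrite /d.
    case: split_ordP => x /eqP; rewrite ?eq_lrshift // => /eqP/lshift_inj <-.
    case: split_ordP => y /eqP; rewrite ?eq_rlshift // => /eqP/rshift_inj <-.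
    by rewrite E => /(_ erefl)/eqP; rewrite eq_lrshift.
  have [s sE] : exists s : 'I_k -> 'I_k, forall l, f l = K (s l).
    by have [s sE] := fin_all_exists fl; exists s.
  have si : injective s.
    move=> l l' ss; have := @di (lshift m l) (lshift m l'); rewrite /d.
    case: split_ordP => x /eqP; rewrite ?eq_lrshift // => /eqP/lshift_inj <-.
    case: split_ordP => y /eqP; rewrite ?eq_lrshift // => /eqP/lshift_inj <-.
    by rewrite !sE ss => /(_ erefl)/lshift_inj.
  case/negP: nPf; apply/codomP; exists (perm si).
  by apply/ffunP => l; rewrite ffunE permE.
pose T := b (fun l => e (K l)) * vol (vcat (fun l => e (K l)) (fun l => e (J l))).
(* [h] is inverted by search; on its image the default 1 is never reached. *)
rewrite (reindex_onto h (fun f => odflt 1%g [pick s | h s == f])) /=; last first.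
  move=> f /codomP[s ->]; case: pickP => [t /eqP //|/(_ s)]; by rewrite eqxx.
rewrite (eq_big predT (fun=> T)) => [|s|s _]; last 2 first.
- rewrite /P codom_f /=; case: pickP => [t /eqP/hi ->|/(_ s)]; by rewrite eqxx.
- have Eh : (fun l => e (h s l)) = (fun l => (fun l => e (K l)) (s l)).
    by apply: funext => l; rewrite ffunE.
  rewrite Eh (form_perm (fun l => e (K l)) s fb).
  rewrite (form_perm (fun l => e (K l)) s (form_vcatl (fun l => e (J l)) fvol)).
  by rewrite mulrACA -expr2 sqrr_sign mul1r.
rewrite sumr_const cardE /= -cardE card_Sn -[T *+ _]mulr_natl mulrA mulVf ?mul1r //.
by rewrite pnatr_eq0 -lt0n fact_gt0.
Qed.

End HodgeDual.

Section SkewKernel.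
Variable (R : realType).

(** det A = det A^T = - det A for odd n. Both uses have n = 5, the codimension of a 2-dimensional
    derived algebra. *)
Lemma skew_odd_ker n (A : 'M[R]_n) : odd n -> A^T = - A ->
  exists2 c : 'rV[R]_n, c != 0 & c *m A = 0.
Proof.
move=> on sA; have dA : \det A = 0.
  have : \det A = - \det A.
    by rewrite -{1}det_tr sA -scaleN1r detZ -signr_odd on expr1 mulN1r.
  by move=> /eqP; rewrite -addr_eq0 -mulr2n mulrn_eq0 => /eqP.
have /det0P[c c0 cA] : \det A == 0 by rewrite dA.
by exists c.
Qed.

End SkewKernel.

(** * Nondegeneracy of G2-structures *)

Section Tuples.
Variables (R : realType) (V : vectType R).
Implicit Types (u v w : V).

(** Arguments are given as lists so that components can be indexed by computable lists; missing
    entries read as 0. *)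
Definition vtup k (s : seq V) : 'I_k -> V := fun i => s`_i.
Arguments vtup : clear implicits.

Lemma vtup_cons k v s : vtup k.+1 (v :: s) = vcons v (vtup k s).
Proof. by rewrite [LHS]vcons_eta. Qed.

Lemma vtup_dfwith k s (i : 'I_k) u : size s = k ->
  vtup k (set_nth 0 s i u) = @dfwith _ (fun=> V) (vtup k s) i u.
Proof.
move=> sk; apply: funext => j; rewrite /vtup nth_set_nth /=.
case: (eqVneq i j) => [->|ij]; first by rewrite dfwith_in eqxx.
by rewrite dfwith_out // eq_sym (negPf (ij : (i : nat) != j)).
Qed.

Lemma vcat_vtup p q s t : size s = p -> vcat (vtup p s) (vtup q t) = vtup (p + q) (s ++ t).
Proof.
move=> sp; apply: funext => i; case: (split_ordP i) => j ->.
  by rewrite vcatl /vtup nth_cat /= sp ltn_ord.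
by rewrite vcatr /vtup nth_cat /= sp ltnNge leq_addr /= addKn.
Qed.

Variables (k : nat) (a : ('I_k -> V) -> R).
Hypothesis fa : is_form a.

Lemma form_vtup_swap s t u v : size (s ++ u :: v :: t) = k ->
  a (vtup k (s ++ v :: u :: t)) = - a (vtup k (s ++ u :: v :: t)).
Proof.
rewrite size_cat /= => sk.
have li : (size s < k)%N by lia.
have lj : ((size s).+1 < k)%N by lia.
rewrite -(form_tperm _ fa (i := Ordinal li) (j := Ordinal lj)); last first.
  by rewrite -val_eqE /= neq_ltn ltnSn.
congr a; apply: funext => l; rewrite /vtup.
case: tpermP => [->|->|/eqP nl /eqP nl'] /=.
- by rewrite !nth_cat ltnn subnn ltnNge leqnSn subSnn.
- by rewrite !nth_cat ltnn subnn ltnNge leqnSn subSnn.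
rewrite -!val_eqE /= in nl nl'.
rewrite !nth_cat; case: ltnP => // sl.
have [m ->] : exists m, (l - size s = m.+2)%N by exists (l - size s).-2; lia.
by [].
Qed.

Lemma form_vtup_eq0 s i j : (i < j < k)%N -> s`_i = s`_j -> a (vtup k s) = 0.
Proof.
move=> /andP[ij jk] sij; have ik := ltn_trans ij jk.
case: fa => _ /(_ _ (Ordinal ik) (Ordinal jk)); apply => //.
by rewrite -val_eqE /= neq_ltn ij.
Qed.

End Tuples.

Arguments vtup {R V} k s.

Section ThreeForms.
Variables (R : realType) (V : vectType R) (a : ('I_3 -> V) -> R).
Hypothesis fa : is_form a.
Definition tri (u v w : V) : R := a (vtup 3 [:: u; v; w]).

Lemma triC12 u v w : tri v u w = - tri u v w.
Proof. exact: (form_vtup_swap fa (s := [::]) (t := [:: w])). Qed.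
Lemma triC23 u v w : tri u w v = - tri u v w.
Proof. exact: (form_vtup_swap fa (s := [:: u]) (t := [::])). Qed.
Lemma tri11 u w : tri u u w = 0.
Proof. exact: (form_vtup_eq0 fa (i := 0) (j := 1)). Qed.
Lemma tri22 u w : tri w u u = 0.
Proof. exact: (form_vtup_eq0 fa (i := 1) (j := 2)). Qed.
Lemma tri_suml (I : Type) (r : seq I) (P : pred I) F v w :
  tri (\sum_(i <- r | P i) F i) v w = \sum_(i <- r | P i) tri (F i) v w.
Proof.
have E u : tri u v w = a (@dfwith _ (fun=> V) (vtup 3 [:: 0; v; w]) ord0 u).
  by rewrite -vtup_dfwith.
rewrite E multilinear_sum; last by case: fa.
by apply: eq_bigr => i _; rewrite E.
Qed.
Lemma triZl c u v w : tri (c *: u) v w = c * tri u v w.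
Proof.
have E x : tri x v w = a (@dfwith _ (fun=> V) (vtup 3 [:: 0; v; w]) ord0 x).
  by rewrite -vtup_dfwith.
by rewrite !E multilinearZ //; case: fa.
Qed.
Lemma tri_summ (I : Type) (r : seq I) (P : pred I) F v w :
  tri v (\sum_(i <- r | P i) F i) w = \sum_(i <- r | P i) tri v (F i) w.
Proof.
by rewrite triC12 tri_suml -sumrN; apply: eq_bigr => i _; rewrite -triC12.
Qed.
Lemma triZm c u v w : tri v (c *: u) w = c * tri v u w.
Proof. by rewrite triC12 triZl -mulrN -triC12. Qed.
Lemma tri_sumr (I : Type) (r : seq I) (P : pred I) F v w :
  tri v w (\sum_(i <- r | P i) F i) = \sum_(i <- r | P i) tri v w (F i).
Proof.
by rewrite triC23 tri_summ -sumrN; apply: eq_bigr => i _; rewrite -triC23.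
Qed.
Lemma triZr c u v w : tri v w (c *: u) = c * tri v w u.
Proof. by rewrite triC23 triZm -mulrN -triC23. Qed.

Lemma tri_interior v (x : 'I_2 -> V) : interior v a x = tri v (x ord0) (x ord_max).
Proof.
rewrite /tri /interior vtup_cons; congr (a (vcons _ _)).
by apply: funext => -[[|[|//]] i] /=; congr x; apply: val_inj.
Qed.

Lemma triE (x : 'I_3 -> V) : a x = tri (x ord0) (x (inord 1)) (x ord_max).
Proof.
by congr a; apply: funext => -[[|[|[|//]]] i]; congr x; apply: val_inj; rewrite /= ?inordK.
Qed.

End ThreeForms.

Section VolumeOnFrame.
Variables (R : realType) (V : vectType R) (n : nat) (vol : ('I_n -> V) -> R).
Hypothesis fvol : is_form vol.

Lemma volume_levi_civita (e : nat -> V) (s : seq nat) :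
  size s = n -> all (ltn^~ n) s ->
  vol (vtup n (map e s)) = (levi_civita n s)%:~R * vol (fun i => e i).
Proof.
move=> sn al; rewrite -det_levi_civita // -top_form //; congr vol.
apply: funext => i; rewrite /vtup.
have si : (i < size s)%N by rewrite sn.
have ln : (nth n s i < n)%N by apply: (allP al); apply: mem_nth.
rewrite (nth_map n) // (bigD1 (Ordinal ln)) //= mxE eqxx scale1r big1 ?addr0 //.
move=> j nj; rewrite mxE; suff /negPf -> : nth n s i != j by rewrite scale0r.
by rewrite eq_sym.
Qed.

End VolumeOnFrame.

Section G2.
Variables (R : realType) (V : vectType R) (phi : ('I_3 -> V) -> R).
Variables (g : {dot V for idfun}) (vol : ('I_7 -> V) -> R).
Hypothesis dV : \dim {:V} = 7%N.
Hypothesis fphi : is_form phi.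
Hypothesis ind : g2_induces phi g vol.

Lemma frame_volume_neq0 (e : 'I_7 -> V) : orthonormal_frame g e -> vol e != 0.
Proof.
by move=> oe; rewrite -normr_eq0; case: ind => -[_ ->] // _; apply: oner_neq0.
Qed.

(* If phi(e_h, -, -) vanished on span(e_2, ..., e_6), then every term of
   ((e_h _| phi) /\ (e_h _| phi) /\ phi)(e_0, ..., e_6) would vanish: the first two
   factors must use up e_0 and e_1, which leaves a component phi(e_h, e_i, e_j). *)
Lemma g2_frame_nondegenerate (e : 'I_7 -> V) (h : 'I_7) : orthonormal_frame g e ->
  (1 < h)%N -> (forall i j : 'I_7, (1 < i)%N -> (1 < j)%N -> tri phi (e h) (e i) (e j) = 0) ->
  False.
Proof.
move=> oe h2 hz; have v0 := frame_volume_neq0 oe.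
have : g (e h) (e h) * vol e != 0 by rewrite oe eqxx mul1r.
case: ind => _ ->; rewrite mulf_eq0 negb_or => /andP[_] /negP; apply; apply/eqP.
rewrite (@wedge_wedge R V 2 2 3) [altsum _ _]big1 ?mulr0 // => s _.
pose t (i : nat) : 'I_7 := s (inord i).
have tE (i : 'I_7) k : i = k :> nat -> s i = t k.
  by move=> ik; congr (s _); apply: val_inj; rewrite /= inordK -?ik.
have tI i j : (i < 7)%N -> (j < 7)%N -> i != j -> t i != t j :> nat.
  move=> i7 j7; apply: contraNneq => /val_inj/perm_inj/(congr1 val) /=.
  by rewrite !inordK // => ->.
rewrite !tri_interior [phi _]triE.
rewrite (tE _ 0%N) // (tE _ 1%N) // (tE _ 2%N) // (tE _ 3%N) // (tE _ 4%N) //.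
rewrite (tE _ 5%N) ?(tE _ 6%N) //=; last by rewrite inordK.
(* A nonzero component phi(e_h, e_a, e_b) has an index in {0, 1}, and neither a nor b is h. *)
have z a b : (tri phi (e h) (e a) (e b) == 0) ||
    [&& (a < 2)%N || (b < 2)%N, a != h & b != h].
  case: eqVneq => //= nz; apply/and3P; split.
  - by apply: contraNT nz; rewrite negb_or -!leqNgt => /andP[a2 b2]; rewrite hz.
  - by apply: contraNneq nz => ->; rewrite tri11.
  - by apply: contraNneq nz => ->; rewrite triC23 // tri11 // oppr0.
have w (a b c : 'I_7) : (1 < a)%N -> (1 < b)%N -> (1 < c)%N -> [|| a == h, b == h | c == h] ->
    tri phi (e a) (e b) (e c) = 0.
  move=> a2 b2 c2 /or3P[] /eqP ->; rewrite ?hz //.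
  - by rewrite triC12 // hz // oppr0.
  - by rewrite triC23 // triC12 // hz // !oppr0.
apply/eqP; rewrite !mulf_eq0 signr_eq0 /= -orbA.
case/orP: (z (t 0%N) (t 1%N)) => [->//|/and3P[t01 t0h t1h]].
case/orP: (z (t 2%N) (t 3%N)) => [->|/and3P[t23 t2h t3h]]; first by rewrite orbT.
apply/orP; right; apply/orP; right; apply/eqP.
have three (k l m : nat) : (k < 2)%N -> (l < 2)%N -> k != l -> k != m -> l != m -> (1 < m)%N.
  by case: k l m => [|[|k]] [|[|l]] [|[|m]].
(* Positions 0, 1 and positions 2, 3 each contain one of the values 0 and 1, so neither value is
   left for positions 4, 5, 6. *)
have big j : (3 < j < 7)%N -> (1 < t j)%N.
  move=> /andP[j3 j7].
  have d k l : (k < 2)%N -> (1 < l < 4)%N -> (t k < 2)%N -> (t l < 2)%N -> (1 < t j)%N.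
    move=> k2 /andP[l1 l4] tk tl; apply: (three _ _ _ tk tl); apply: tI; lia.
  by case/orP: t01 => p; case/orP: t23 => q; [apply: d p q | apply: d p q | apply: d p q | apply: d p q].
apply: w; rewrite ?big //.
(* The value h occurs at some position; positions 0 to 3 avoid it, so e_h is an argument of the last
   factor. *)
have [j jE] : exists j : 'I_7, h = s j by exists (s^-1%g h); rewrite permKV.
have hj := tE j j erefl; rewrite -jE in hj.
case: j jE hj => [[|[|[|[|[|[|[|//]]]]]]] lj] _ /= hj;
  by rewrite hj ?eqxx ?orbT // in t0h t1h t2h t3h *.
Qed.

(** The hypotheses on h concern only the complement of e_0 and e_1, so the frame can be changed
    there to have the normalized h as its third vector; the frame version then applies. *)
Lemma g2_nondegenerate (e : 'I_7 -> V) (h : V) : orthonormal_frame g e ->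
  g h (e ord0) = 0 -> g h (e (inord 1)) = 0 ->
  (forall i j : 'I_7, (1 < i)%N -> (1 < j)%N -> tri phi h (e i) (e j) = 0) ->
  h = 0.
Proof.
move=> oe h0 h1 hz; apply/eqP; apply: contraT => hn0; exfalso.
pose h' := (Num.sqrt (g h h))^-1 *: h.
have ghh : g h' h' = 1 by exact: dot_normalize.
pose e0 := e ord0; pose e1 := e (inord 1).
have n01 : (ord0 == inord 1 :> 'I_7) = false by rewrite -val_eqE /= inordK.
have he0 : g h' e0 = 0 by rewrite dotZl h0 mulr0.
have he1 : g h' e1 = 0 by rewrite dotZl h1 mulr0.
have e0h : g e0 h' = 0 by rewrite dotC.
have e1h : g e1 h' = 0 by rewrite dotC.
have oh : orthonormal_seq g [:: e0; e1; h'].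
  move=> [|[|[|i]]] [|[|[|j]]] //= _ _; rewrite ?he0 ?he1 ?e0h ?e1h ?ghh //.
  - by rewrite oe eqxx.
  - by rewrite oe n01.
  - by rewrite oe eq_sym n01.
  - by rewrite oe eqxx.
have [e' oe' E] := orthonormal_frame_of oh dV.
have E0 : e' ord0 = e0 by rewrite E.
have E1 : e' (inord 1) = e1 by rewrite E inordK.
have E2 : e' (inord 2) = h' by rewrite E inordK.
apply: (g2_frame_nondegenerate (h := inord 2) oe'); first by rewrite inordK.
move=> i j i2 j2.
have perp (k : 'I_7) : (1 < k)%N -> e' k = \sum_(l < 7 | (1 < l)%N) g (e' k) (e l) *: e l.
  move=> k2; rewrite [LHS](frame_expand _ dV oe) (bigID (fun l : 'I_7 => (1 < l)%N)) /=.
  rewrite [X in _ + X]big1 ?addr0 // => l l2.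
  have /orP[/eqP ->|/eqP ->] : (l == ord0) || (l == inord 1).
    by rewrite -!val_eqE /= inordK //; lia.
  - by rewrite -/e0 -E0 oe' -val_eqE /= gtn_eqF ?scale0r // ltnW.
  - by rewrite -/e1 -E1 oe' -val_eqE /= inordK // gtn_eqF ?scale0r.
rewrite E2 triZl // (perp i i2) (perp j j2) tri_summ // big1 ?mulr0 // => k k2.
rewrite triZm // tri_sumr // big1 ?mulr0 // => l l2.
by rewrite triZr // hz // mulr0.
Qed.

End G2.

Section Differential.
Variables (R : realType) (n : vectType R) (br : {bilinear n -> n -> n}).

Lemma ce_diff4 (a : ('I_4 -> n) -> R) x0 x1 x2 x3 x4 :
  ce_diff br a (vtup 5 [:: x0; x1; x2; x3; x4]) =
  - a (vtup 4 [:: br x0 x1; x2; x3; x4]) + a (vtup 4 [:: br x0 x2; x1; x3; x4])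
  - a (vtup 4 [:: br x0 x3; x1; x2; x4]) + a (vtup 4 [:: br x0 x4; x1; x2; x3])
  - a (vtup 4 [:: br x1 x2; x0; x3; x4]) + a (vtup 4 [:: br x1 x3; x0; x2; x4])
  - a (vtup 4 [:: br x1 x4; x0; x2; x3]) - a (vtup 4 [:: br x2 x3; x0; x1; x4])
  + a (vtup 4 [:: br x2 x4; x0; x1; x3]) - a (vtup 4 [:: br x3 x4; x0; x1; x2]).
Proof.
set s := [:: x0; x1; x2; x3; x4].
have E (i : 'I_5) (j : 'I_4) :
    vcons (br (vtup 5 s i) (vtup 5 s (lift i j)))
          (fun l => vtup 5 s (lift i (lift j l))) =
    vtup 4 (br s`_i s`_(bump i j) :: [seq s`_(bump i (bump j l)) | l <- iota 0 3]).
  rewrite [RHS]vtup_cons; congr (vcons _ _); apply: funext => l.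
  by rewrite /vtup (nth_map 0%N) ?size_iota ?nth_iota ?add0n.
rewrite /ce_diff; under eq_bigr do under eq_bigr do rewrite E.
under eq_bigr do rewrite big_mkcond.
rewrite /= !big_ord_recl !big_ord0 /=.
rewrite /bump /=.
by rewrite !exprS !expr0; ring.
Qed.
End Differential.

(** * Coclosed G2-structures force a central direction outside the derived algebra *)

Section KernelBracket.
Variables (R : realType) (n : vectType R) (br : {bilinear n -> n -> n}).
Variables (phi : ('I_3 -> n) -> R) (g : {dot n for idfun}) (vol : ('I_7 -> n) -> R).
Hypotheses (dn : \dim {:n} = 7%N) (fphi : is_form phi) (ind : g2_induces phi g vol).
Local Notation psi := (@hodge R n g 3 4 vol phi).
Hypothesis dpsi : forall x, ce_diff br psi x = 0.
Variable e : 'I_7 -> n.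
Hypothesis oe : orthonormal_frame g e.
Local Notation E i := (e (inord i%N)).

Lemma psi_form : is_form psi.
Proof. by apply: (hodge_form (k := 3) (m := 4) dn oe) => //; case: ind => -[]. Qed.

(** [vol e] is 1 or -1 according to the orientation; it stays as a common factor, of which only the
    nonvanishing matters. *)
Lemma psiE (a b c p q r s : nat) :
  uniq [:: a; b; c; p; q; r; s] -> all (ltn^~ 7%N) [:: a; b; c; p; q; r; s] ->
  psi (vtup 4 [:: E p; E q; E r; E s]) =
  tri phi (E a) (E b) (E c) * ((levi_civita 7 [:: a; b; c; p; q; r; s])%:~R * vol e).
Proof.
move=> un al; have fvol : is_form vol by case: ind => -[].
pose l := [:: a; b; c; p; q; r; s].
pose K (i : 'I_3) : 'I_7 := inord (nth 0%N l i).
pose J (i : 'I_4) : 'I_7 := inord (nth 0%N l (3 + i)).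
have l7 i : (i < 7)%N -> (nth 0%N l i < 7)%N by move=> i7; apply: (allP al); rewrite mem_nth.
have lI i j : (i < 7)%N -> (j < 7)%N -> inord (nth 0%N l i) = inord (nth 0%N l j) :> 'I_7 -> i = j.
  move=> i7 j7 /(congr1 val) /=; rewrite !inordK ?l7 // => /eqP.
  by rewrite nth_uniq // => /eqP.
have Ki : injective K.
  by move=> [i li] [j lj] /lI H; apply: val_inj; apply: H; rewrite ?(ltn_trans li) ?(ltn_trans lj).
have Ji : injective J.
  by move=> i j /lI H; apply/val_inj/(@addnI 3)/H; rewrite (ltn_add2l 3 _ 4).
have KJ i j : K i != J j.
  apply/eqP => /lI H; have : (i : nat) = (3 + j)%N.
    by apply: H; [apply: (ltn_trans (ltn_ord i)) | rewrite (ltn_add2l 3 _ 4)].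
  by move=> ij; have := ltn_ord i; rewrite ij ltnNge leq_addr.
have := hodge_dual (k := 3) (m := 4) dn oe fvol fphi Ki Ji KJ.
have -> : (fun i => e (J i)) = vtup 4 [:: E p; E q; E r; E s].
  by apply: funext => -[[|[|[|[|//]]]] i].
have -> : (fun i => e (K i)) = vtup 3 [:: E a; E b; E c].
  by apply: funext => -[[|[|[|//]]] i].
move=> ->; congr (_ * _); rewrite vcat_vtup //=.
rewrite -[[:: E a; _; _; _; _; _; _]]/(map (fun i => E i) l).
rewrite (volume_levi_civita fvol) //; congr (_ * vol _).
by apply: funext => i; rewrite inord_val.
Qed.

(** The frame is adapted: brackets lie in the span of [E 0] and [E 1], and [E 2] is the kernel
    vector of psi([E 0], [E 1], -, -) among the remaining directions. *)
Hypothesis central : forall x, br (E 0) x = 0.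
Hypothesis derived : forall x y,
  br x y = g (br x y) (E 0) *: E 0 + g (br x y) (E 1) *: E 1.
Hypothesis kernel : forall d, (2 < d < 7)%N -> psi (vtup 4 [:: E 0; E 1; E 2; E d]) = 0.

Let alpha i := g (br (E 2) (E i)) (E 1).

(** Contraction with [E 0] kills the [E 0] component of the bracket, so only g([-, -], [E 1]) is
    seen; the other component requires exchanging the two vectors. *)
Lemma psi_bracket x y u v :
  psi (vtup 4 [:: br x y; E 0; u; v]) =
  g (br x y) (E 1) * psi (vtup 4 [:: E 1; E 0; u; v]).
Proof.
have sc := scalar_vcons (vtup 3 [:: E 0; u; v]) (is_form_multilinear psi_form).
rewrite derived [X in psi X = _]vtup_cons sc -[_ *: E 1]addr0 sc.
rewrite -!vtup_cons (form_vtup_eq0 psi_form (i := 0) (j := 1)) //.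
have -> : psi (vtup 4 [:: 0; E 0; u; v]) = 0 by rewrite vtup_cons (scalar0 sc).
rewrite mulr0 add0r addr0 !dotDl !dotZl !oe eqxx.
have -> : (inord 0 == inord 1 :> 'I_7) = false by rewrite -val_eqE /= !inordK.
by rewrite mulr0 mulr1 add0r addr0.
Qed.

(** Up to sign this is w /\ tau evaluated on [E 2], [E a], [E b], [E c], where w = g([-, -], [E 1]).
    As [E 2] is in the kernel of tau, only the brackets with [E 2] survive. *)
Lemma bracket_relation a b c : (2 < a < 7)%N -> (2 < b < 7)%N -> (2 < c < 7)%N ->
  alpha a * psi (vtup 4 [:: E 1; E 0; E b; E c]) -
  alpha b * psi (vtup 4 [:: E 1; E 0; E a; E c]) +
  alpha c * psi (vtup 4 [:: E 1; E 0; E a; E b]) = 0.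
Proof.
move=> ha hb hc; have := dpsi (vtup 5 [:: E 0; E 2; E a; E b; E c]).
have z u v w : psi (vtup 4 [:: 0; u; v; w]) = 0.
  by rewrite vtup_cons (scalar0 (scalar_vcons _ (is_form_multilinear psi_form))).
have k d : (2 < d < 7)%N -> psi (vtup 4 [:: E 1; E 0; E 2; E d]) = 0.
  move=> hd; rewrite (form_vtup_swap psi_form (s := [::]) (t := [:: E 2; E d])) //.
  by rewrite kernel // oppr0.
rewrite ce_diff4 !central !z !psi_bracket !k // -/(alpha a) -/(alpha b) -/(alpha c).
lra.
Qed.

(* With h = sum_i alpha_i e_i, the relations say phi(e_2, h, -) = 0 on
   span(e_2, ..., e_6), and the hypothesis [kernel] says phi(e_i, e_j, e_k) = 0 for
   i, j, k > 2; so h = 0 by nondegeneracy. *)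
Lemma kernel_bracket i : (2 < i < 7)%N -> alpha i = 0.
Proof.
have ve : vol e != 0 by apply: (frame_volume_neq0 ind).
pose r := [:: 3; 4; 5; 6]%N.
pose h := \sum_(l <- r) alpha l *: E l.
have sep k l : (k < 7)%N -> (l < 7)%N -> g (E k) (E l) = (k == l)%:R.
  by move=> k7 l7; rewrite oe -val_eqE /= !inordK.
have rP l : (l \in r) = (2 < l < 7)%N by rewrite !inE; lia.
have r4 l : l \in r -> [\/ l = 3, l = 4, l = 5 | l = 6]%N.
  rewrite rP => lr; have [->|[->|[->|->]]] : (l = 3 \/ l = 4 \/ l = 5 \/ l = 6)%N by lia.
  - exact: Or41.
  - exact: Or42.
  - exact: Or43.
  - exact: Or44.
have z a b c : a \in r -> b \in r -> c \in r -> tri phi (E a) (E b) (E c) = 0.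
  move=> ar br' cr; have [un|] := boolP (uniq [:: a; b; c]); last first.
    rewrite /= !inE !andbT negb_and !negbK => /orP[/orP[]|] /eqP ->.
    - exact: tri11.
    - by rewrite triC23 // tri11 // oppr0.
    - exact: tri22.
  have [d dr [un' al nz]] : exists2 d, d \in r & [/\ uniq [:: a; b; c; 0; 1; 2; d]%N,
      all (ltn^~ 7%N) [:: a; b; c; 0; 1; 2; d]%N &
      levi_civita 7 [:: a; b; c; 0; 1; 2; d]%N != 0].
    (* 3 + 4 + 5 + 6 = 18, so this is the index left over by a, b, c. *)
    exists (18 - a - b - c)%N; case: (r4 _ ar) un => ->; case: (r4 _ br') => ->;
      case: (r4 _ cr) => ->; by vm_compute.
  have : psi (vtup 4 [:: E 0; E 1; E 2; E d]) = 0 by rewrite kernel // -rP.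
  rewrite (psiE un' al) => /eqP.
  by rewrite !mulf_eq0 intr_eq0 (negPf nz) (negPf ve) !orbF => /eqP.
(* Up to sign and [vol e], psi([E 1], [E 0], [E y], [E z]) is the complementary component phi([E 2],
   [E x], [E d]). *)
pose J x d y z := [:: 2; x; d; 1; 0; y; z]%N.
(* The signs s, -s, s match the alternating signs of the bracket relation, so a common factor s
   cancels. *)
have rel a b c d (s : int) : s != 0 ->
    all (fun i => 2 < i < 7)%N [:: a; b; c; d] ->
    all (fun l => uniq l && all (ltn^~ 7%N) l) [:: J a d b c; J b d a c; J c d a b] ->
    levi_civita 7 (J a d b c) = s -> levi_civita 7 (J b d a c) = - s ->
    levi_civita 7 (J c d a b) = s ->
    alpha a * tri phi (E 2) (E a) (E d) + alpha b * tri phi (E 2) (E b) (E d)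
    + alpha c * tri phi (E 2) (E c) (E d) = 0.
  move=> s0 /and5P[ha hb hc hd _] /and4P[/andP[una ala] /andP[unb alb] /andP[unc alc] _] l1 l2 l3.
  have := bracket_relation ha hb hc.
  rewrite (psiE una ala) (psiE unb alb) (psiE unc alc) l1 l2 l3.
  rewrite rmorphN /= mulNr => H.
  have sv : s%:~R * vol e != 0 by rewrite mulf_neq0 ?intr_eq0.
  by apply: (mulIf sv); rewrite mul0r -[RHS]H; ring.
have rel_sum d : d \in r -> \sum_(l <- r) alpha l * tri phi (E 2) (E l) (E d) = 0.
  rewrite !big_cons big_nil addr0 => /r4[] ->;
    rewrite tri22 // mulr0 ?add0r ?addr0 ?addrA.
  - by apply: (rel _ _ _ _ (levi_civita 7 (J 4 3 5 6)%N)).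
  - by apply: (rel _ _ _ _ (levi_civita 7 (J 3 4 5 6)%N)).
  - by apply: (rel _ _ _ _ (levi_civita 7 (J 3 5 4 6)%N)).
  - by apply: (rel _ _ _ _ (levi_civita 7 (J 3 6 4 5)%N)).
have h0 : h = 0.
  apply: (g2_nondegenerate dn fphi ind oe).
  - rewrite dot_suml big_seq big1 // => l; rewrite rP => hl.
    rewrite dotZl -[ord0]inord_val /= sep ?gtn_eqF ?mulr0 //; lia.
  - rewrite dot_suml big_seq big1 // => l; rewrite rP => hl.
    rewrite dotZl sep ?gtn_eqF ?mulr0 //; lia.
  move=> i' j' hi hj; have li := ltn_ord i'; have lj := ltn_ord j'; rewrite -[i']inord_val -[j']inord_val tri_suml //.
  have [i2|i2] := eqVneq (i' : nat) 2%N; have [j2|j2] := eqVneq (j' : nat) 2%N.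
  - by rewrite big1 // => l _; rewrite triZl // i2 j2 tri22 // mulr0.
  - transitivity (- \sum_(l <- r) alpha l * tri phi (E 2) (E l) (E j')).
      by rewrite -sumrN; apply: eq_bigr => l _; rewrite triZl // triC12 // mulrN i2.
    by rewrite rel_sum ?oppr0 // rP; lia.
  - transitivity (\sum_(l <- r) alpha l * tri phi (E 2) (E l) (E i')).
      by apply: eq_bigr => l _; rewrite triZl // triC23 // triC12 // opprK j2.
    by rewrite rel_sum // rP; lia.
  - have [ir jr] : (i' : nat) \in r /\ (j' : nat) \in r by rewrite !rP; lia.
    by rewrite big_seq big1 // => l lr; rewrite triZl // z ?mulr0.
rewrite -rP => ir; have := congr1 (g^~ (E i)) h0; rewrite /= dot0l dot_suml.
rewrite (bigD1_seq i) //= big_seq_cond big1 ?addr0 => [|l /andP[lr li]].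
  by rewrite dotZl oe eqxx mulr1.
by move: lr ir; rewrite !rP => lr ir; rewrite dotZl sep ?(negPf li) ?mulr0 //; lia.
Qed.

End KernelBracket.

(** * Brackets, ideals and central vectors *)

Section TwoStep.
Variables (R : realType) (n : vectType R) (br : {bilinear n -> n -> n}).
Hypothesis hlie : is_lie_bracket br.
Local Notation D := (derived_algebra br).

Lemma bracket_antisym x y : br y x = - br x y.
Proof.
have [alt _] := hlie; apply/eqP; rewrite -addr_eq0.
have := alt (x + y); rewrite linearDl !linearDr !alt add0r addr0 => E.
by rewrite addrC E.
Qed.

Lemma bracket_sumr (I : Type) (r : seq I) (P : pred I) F x :
  br x (\sum_(i <- r | P i) F i) = \sum_(i <- r | P i) br x (F i).
Proof. exact: linear_sumr. Qed.
Lemma bracket_suml (I : Type) (r : seq I) (P : pred I) F x :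
  br (\sum_(i <- r | P i) F i) x = \sum_(i <- r | P i) br (F i) x.
Proof. exact: linear_sumlz. Qed.
Lemma bracketZr c x y : br x (c *: y) = c *: br x y.
Proof. exact: linearZr_LR. Qed.
Lemma bracketZl c x y : br (c *: x) y = c *: br x y.
Proof. exact: linearZl_LR. Qed.
Lemma bracketDr x y z : br x (y + z) = br x y + br x z.
Proof. exact: linearDr. Qed.
Lemma bracketDl x y z : br (y + z) x = br y x + br z x.
Proof. exact: linearDl. Qed.

Lemma mem_derived x y : br x y \in D.
Proof.
rewrite (coord_vbasis (memvf x)) (coord_vbasis (memvf y)) bracket_suml.
apply: memv_suml => i _; rewrite bracket_sumr; apply: memv_suml => j _.
rewrite bracketZr bracketZl !memvZ // memv_span //.
by apply: allpairs_f; apply: mem_nth; rewrite size_tuple.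
Qed.

(** Every subspace containing D is an ideal, so a complement of Ru that contains D splits Ru off. It
    is nonzero because the algebra is not abelian. *)
Lemma reducible_of_central u : (exists x y, br x y != 0) -> is_central br u ->
  u \notin D -> is_reducible br.
Proof.
move=> [x0 [y0 nab]] cu uD.
have u0 : u != 0 by apply: contraNneq uD => ->; apply: mem0v.
pose W := (D + <[u]>)%VS.
exists <[u]>%VS, (D + W^C)%VS; split.
- split=> x y; last by rewrite -[br x y]addr0 => _; rewrite memv_add ?mem_derived ?mem0v.
  by move=> /vlineP[c ->]; rewrite bracketZr bracket_antisym cu oppr0 scaler0 mem0v.
- split; first by rewrite -dimv_eq0 dim_vline u0.
  apply: contraNneq nab => DW; have := mem_derived x0 y0.
  by move/(subvP (addvSl D W^C)); rewrite DW memv0.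
- by rewrite addvA [(<[u]> + D)%VS]addvC addv_complf.
- apply/eqP; rewrite -subv0; apply/subvP => x /memv_capP[/vlineP[c ->]].
  move=> /memv_addP[d dD [w wW E]].
  have : w \in (W :&: W^C)%VS.
    rewrite memv_cap wW andbT.
    have -> : w = - d + c *: u by rewrite E addKr.
    by rewrite memv_add ?memvN // memvZ // memv_line.
  rewrite capv_compl memv0 => /eqP w0; rewrite w0 addr0 in E.
  have [->|c0] := eqVneq c 0; first by rewrite scale0r mem0v.
  by case/negP: uD; rewrite -[u](scalerK c0) E memvZ.
Qed.

End TwoStep.

Section NoCoclosed.
Variables (R : realType) (n : vectType R) (br : {bilinear n -> n -> n}).
Hypotheses (hlie : is_lie_bracket br) (dn : \dim {:n} = 7%N).
Hypothesis hnil : is_two_step_nilpotent br.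
Local Notation D := (derived_algebra br).

Lemma coclosed_reducible (phi : ('I_3 -> n) -> R) :
  \dim D = 2%N -> is_coclosed_g2 br phi -> is_reducible br.
Proof.
move=> dD [[fphi _] [g [vol [ind dpsi]]]].
have [nab cD] := hnil.
have [s [os sD ss]] := orthonormal_basis g D.
have sp := orthonormal_spans os sD ss; rewrite dD in ss.
have [f of_ fE] := orthonormal_frame_of os dn.
pose F (i : nat) := f (inord i).
have FE i : (i < 2)%N -> F i = s`_i.
  by move=> i2; rewrite /F fE inordK ?ss // (leq_trans i2).
have FD i : (i < 2)%N -> F i \in D.
  by move=> i2; rewrite FE // sD // mem_nth // ss.
have sF : s = [:: F 0; F 1]%N.
  rewrite (FE 0%N) // (FE 1%N) //; case: (s) ss => [|a [|b [|? ?]]] //=.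
have derivedE x y : br x y = g (br x y) (F 0%N) *: F 0%N + g (br x y) (F 1%N) *: F 1%N.
  have := @orthonormal_span _ _ g s (br x y) os; rewrite sp => /(_ (mem_derived _ _ _)).
  by rewrite ss !big_ord_recl big_ord0 addr0 sF.
pose psi := @hodge R n g 3 4 vol phi.
have fpsi : is_form psi := psi_form dn fphi ind of_.
(* [B] is the 2-form tau. *)
pose B x y := psi (vtup 4 [:: F 0%N; F 1%N; x; y]).
have Balt x y : B y x = - B x y.
  exact: (form_vtup_swap fpsi (s := [:: F 0%N; F 1%N]) (t := [::])).
have BE x y : B x y = psi (vcons x (vtup 3 [:: F 0%N; F 1%N; y])).
  rewrite /B (form_vtup_swap fpsi (s := [:: F 0%N]) (u := x) (t := [:: y])) //.
  by rewrite (form_vtup_swap fpsi (s := [::]) (u := x) (t := [:: F 1%N; y])) // opprK -vtup_cons.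
have Bsum (I : Type) (r : seq I) (c : I -> R) (x : I -> n) y :
    B (\sum_(i <- r) c i *: x i) y = \sum_(i <- r) c i * B (x i) y.
  have sc := scalar_vcons (vtup 3 [:: F 0%N; F 1%N; y]) (is_form_multilinear fpsi).
  rewrite BE (scalar_sum sc); apply: eq_bigr => i _.
  by rewrite (scalar_scale _ _ sc) -BE.
(* The matrix of tau on the complement of D, where the frame starts at index 2. *)
pose A : 'M[R]_5 := \matrix_(i, j) B (F i.+2) (F j.+2).
have [c c0 cA] : exists2 c : 'rV[R]_5, c != 0 & c *m A = 0.
  by apply: skew_odd_ker => //; apply/matrixP => i j; rewrite !mxE.
pose v := \sum_(i < 5) c 0 i *: F i.+2.
have gF i j : (i < 7)%N -> (j < 7)%N -> g (F i) (F j) = (i == j)%:R.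
  by move=> i7 j7; rewrite of_ -val_eqE /= !inordK.
have gv (i : 'I_5) : g v (F i.+2) = c 0 i.
  rewrite dot_suml (bigD1 i) //= big1 ?addr0 => [|j /negPf ij].
    by rewrite dotZl gF ?eqxx ?mulr1 // (ltn_add2l 2 _ 5).
  by rewrite dotZl gF ?(ltn_add2l 2 _ 5) // !eqSS val_eqE ij mulr0.
have v0 : v != 0.
  apply: contraNneq c0 => v0; apply/eqP/rowP => i.
  by rewrite -gv v0 dot0l mxE.
have gv0 i : (i < 2)%N -> g v (F i) = 0.
  move=> i2; rewrite dot_suml big1 // => j _; rewrite dotZl gF ?(ltn_add2l 2 _ 5) //.
    by rewrite gtn_eqF ?mulr0 // (leq_trans i2).
  by rewrite (leq_trans i2).
pose u := (Num.sqrt (g v v))^-1 *: v.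
have guu : g u u = 1 by exact: dot_normalize.
have gu i : (i < 2)%N -> g u (F i) = 0 by move=> i2; rewrite dotZl gv0 ?mulr0.
have ou : orthonormal_seq g [:: F 0%N; F 1%N; u].
  move=> [|[|[|i]]] [|[|[|j]]] //= _ _; rewrite ?gF ?guu ?[g _ u]dotC ?gu //.
(* A second frame, again starting with a basis of D, has the unit kernel vector u in position 2. *)
have [e oe eE] := orthonormal_frame_of ou dn.
have e0 : e (inord 0) = F 0%N by rewrite eE inordK.
have e1 : e (inord 1) = F 1%N by rewrite eE inordK.
have e2 : e (inord 2) = u by rewrite eE inordK.
have BvF (y : 'I_7) : B v (F y) = 0.
  have [y2|y2] := ltnP y 2.
    apply: (form_vtup_eq0 fpsi (i := y) (j := 3)); first by rewrite (leq_trans y2).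
    by case: (nat_of_ord y) y2 => [|[]].
  have y5 : (y - 2 < 5)%N by have := ltn_ord y; lia.
  have := congr1 (fun M : 'rV_5 => M 0 (Ordinal y5)) cA.
  rewrite !mxE Bsum => E; rewrite -[RHS]E; apply: eq_bigr => i _.
  by rewrite mxE /=; congr (_ * B _ (F _)); lia.
have Bu y : B u y = 0.
  have -> : B u y = (Num.sqrt (g v v))^-1 * B v y.
    have := Bsum _ [:: tt] (fun=> (Num.sqrt (g v v))^-1) (fun=> v) y.
    by rewrite !big_seq1.
  rewrite Balt (frame_expand y dn of_) Bsum big1 ?oppr0 ?mulr0 // => i _.
  by rewrite Balt -[f i]/(f i) -{2}[i]inord_val BvF oppr0 mulr0.
have cF i x : (i < 2)%N -> br (F i) x = 0 by move=> /FD /cD.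
have swap01 : e (inord 0) \in D /\ e (inord 1) \in D by rewrite e0 e1 !FD.
have ub (i : nat) : (2 < i < 7)%N -> br u (e (inord i)) = 0.
  move=> hi; rewrite derivedE.
  have -> : g (br u (e (inord i))) (F 1%N) = 0.
    rewrite -e1 -e2; apply: (kernel_bracket dn fphi ind dpsi oe) => //.
    - by move=> x; rewrite e0 cF.
    - by move=> x y; rewrite e0 e1; apply: derivedE.
    - by move=> d _; rewrite e0 e1 e2; apply: Bu.
  (* One frame yields one component of the bracket; exchanging its first two vectors yields the
     other. *)
  pose t : 'S_7 := tperm (inord 0) (inord 1).
  pose e' j := e (t j).
  have oe' : orthonormal_frame g e' by move=> j k; rewrite oe (inj_eq perm_inj).
  have t0 : e' (inord 0) = F 1%N by rewrite /e' tpermL e1.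
  have t1 : e' (inord 1) = F 0%N by rewrite /e' tpermR e0.
  have te j : (1 < j < 7)%N -> e' (inord j) = e (inord j).
    by move=> hj; rewrite /e' tpermD // -val_eqE /= !inordK; lia.
  have -> : g (br u (e (inord i))) (F 0%N) = 0.
    rewrite -t1 -e2 -!te ?(andP hi).2 ?(ltnW (andP hi).1) //.
    apply: (kernel_bracket dn fphi ind dpsi oe') => //.
    - by move=> x; rewrite t0 cF.
    - by move=> x y; rewrite t0 t1 addrC; apply: derivedE.
    - move=> d _; rewrite t0 t1 te // e2 -/psi.
      have /= -> := form_vtup_swap fpsi (s := [::]) (u := F 0%N) (v := F 1%N)
        (t := [:: u; e' (inord d)]) erefl.
      by rewrite -/(B _ _) Bu oppr0.
  by rewrite !scale0r addr0.
have [alt _] := hlie.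
apply: (reducible_of_central hlie nab (u := u)).
- move=> y; rewrite (frame_expand y dn oe) bracket_sumr big1 // => i _.
  rewrite bracketZr -[i]inord_val.
  have [i2|] := ltnP i 2.
    rewrite bracket_antisym // (_ : e _ = F i) ?cF ?oppr0 ?scaler0 //.
    by case: (nat_of_ord i) i2 => [|[]].
  rewrite leq_eqVlt => /orP[/eqP <-|i2]; first by rewrite e2 alt scaler0.
  by rewrite ub ?scaler0 // i2 ltn_ord.
- apply/negP => uD.
  have := orthonormal_span os (x := u); rewrite sp => /(_ uD).
  rewrite ss !big_ord_recl big_ord0 addr0 sF /= !gu // !scale0r addr0 => u0.
  by move: guu; rewrite u0 dot0l => /eqP; rewrite eq_sym oner_eq0.
Qed.

End NoCoclosed.

(** * The model G2-structure of an orthonormal frame *)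

Section IntegerSums.

(** A plain fold over integers, so that it reduces under [vm_compute]. *)
Definition isum (T : Type) (F : T -> int) (s : seq T) : int :=
  foldr (fun x c => F x + c) 0 s.

Lemma isumE (R : nzRingType) (T : Type) (F : T -> int) s :
  (isum F s)%:~R = \sum_(x <- s) (F x)%:~R :> R.
Proof.
elim: s => [|x s IH]; first by rewrite big_nil.
by rewrite big_cons -IH -rmorphD.
Qed.

(** Collects terms by the index h t; the inner sums are the integer coefficients that get
    evaluated. *)
Lemma sum_by_index (R : nzRingType) (T : Type) (s : seq T) (h : T -> nat) (m : nat)
    (c : T -> R) (v : nat -> R) : all (fun t => h t < m)%N s ->
  \sum_(t <- s) c t * v (h t) =
  \sum_(a < m) (\sum_(t <- [seq t <- s | h t == a]) c t) * v a.
Proof.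
elim: s => [_|t s IH /andP[ht hs]].
  by rewrite big_nil big1 // => a _; rewrite big_nil mul0r.
rewrite big_cons IH // (bigD1 (Ordinal ht)) //= [in RHS](bigD1 (Ordinal ht)) //=.
rewrite eqxx big_cons mulrDl -!addrA; congr (_ + (_ + _)).
by apply: eq_bigr => a; rewrite -val_eqE /= eq_sym => /negPf ->.
Qed.

End IntegerSums.

(* phi = e^012 + e^034 + e^056 + e^135 - e^146 - e^236 - e^245, as the list of its
   42 nonzero components. *)
Definition g2_terms : seq (int * seq nat) :=
  flatten [seq let: (c, (i, j, k)) := t in
    [:: (c, [:: i; j; k]); (c, [:: j; k; i]); (c, [:: k; i; j]);
        (- c, [:: j; i; k]); (- c, [:: i; k; j]); (- c, [:: k; j; i])]
  | t <- [:: (1, (0, 1, 2)%N); (1, (0, 3, 4)%N); (1, (0, 5, 6)%N); (1, (1, 3, 5)%N);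
             (-1, (1, 4, 6)%N); (-1, (2, 3, 6)%N); (-1, (2, 4, 5)%N)]].

(* The coefficient of 1/24 g(v, e_a) g(w, e_b) vol in
   (v _| phi) /\ (w _| phi) /\ phi; note 144 = 24 * 6. *)
Definition g2_gram (a b : nat) : int :=
  isum (fun t : int * seq nat => isum (fun t' : int * seq nat => isum (fun t'' : int * seq nat =>
     t.1 * t'.1 * t''.1 * levi_civita 7 (behead t.2 ++ behead t'.2 ++ t''.2))
    g2_terms) [seq t <- g2_terms | head 0%N t.2 == b]) [seq t <- g2_terms | head 0%N t.2 == a].

Lemma g2_gram_check :
  all (fun a => all (fun b => g2_gram a b == if a == b then 144 else 0) (iota 0 7)) (iota 0 7).
Proof. vm_compute. reflexivity. Qed.

Lemma g2_gramE a b : (a < 7)%N -> (b < 7)%N -> g2_gram a b = if a == b then 144 else 0.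
Proof.
move=> a7 b7; have /allP/(_ a) := g2_gram_check; rewrite mem_iota => /(_ a7).
by move=> /allP/(_ b); rewrite mem_iota => /(_ b7)/eqP.
Qed.

Lemma prod_ord7 (R : comNzRingType) (F : 'I_7 -> R) :
  \prod_i F i = F (inord 0) * F (inord 1) * F (inord 2) * F (inord 3) *
               F (inord 4) * F (inord 5) * F (inord 6).
Proof.
rewrite !big_ord_recl big_ord0 mulr1 !mulrA.
by do !congr (_ * _); congr F; apply: val_inj; rewrite /= inordK.
Qed.

Lemma g2_terms_shape (t : int * seq nat) : t \in g2_terms ->
  exists abc : nat * nat * nat, let: (a, b, c) := abc in
    t.2 = [:: a; b; c] /\ [/\ a < 7, b < 7 & c < 7]%N.
Proof.
have : all (fun t : int * seq nat => (size t.2 == 3%N) && all (ltn^~ 7%N) t.2) g2_terms by [].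
move=> /allP H /H; case: t => s [|a [|b [|c [|]]]] //= /and4P[a7 b7 c7 _].
by exists (a, b, c).
Qed.

Section Model.
Variables (R : realType) (V : vectType R) (g : {dot V for idfun}).
Hypothesis dV : \dim {:V} = 7%N.
Variable e : 'I_7 -> V.
Hypothesis oe : orthonormal_frame g e.
Local Notation E i := (e (inord i%N)).

Definition frame_volume (x : 'I_7 -> V) : R := \det (\matrix_(i, j) g (x i) (e j)).

Definition g2_model (x : 'I_3 -> V) : R :=
  \sum_(t <- g2_terms) t.1%:~R * \prod_(i < 3) g (x i) (E (nth 0 t.2 i)).

Lemma scalar_prod_multilinear k (c : 'I_k -> V -> R) :
  (forall i, scalar (c i)) -> multilinear (fun x => \prod_i c i (x i)).
Proof.
move=> sc x i a u v.
have E w : \prod_j c j (@dfwith _ (fun=> V) x i w j) =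
           c i w * \prod_(j < k | j != i) c j (x j).
  rewrite (bigD1 i) //= dfwith_in; congr (_ * _).
  by apply: eq_bigr => j ji; rewrite dfwith_out // eq_sym.
by rewrite !E sc mulrDl mulrA.
Qed.

Lemma frame_volume_form : is_form frame_volume.
Proof.
have -> : frame_volume = altsum (fun y => \prod_i g (y i) (e i)).
  apply: funext => x; rewrite (altsum_prod (fun i u => g u (e i))) -det_tr /frame_volume; congr (\det _).
  by apply/matrixP => i j; rewrite !mxE.
apply: altsum_form; apply: (scalar_prod_multilinear (c := fun i u => g u (e i))) => i a u v /=.
by rewrite dotDl dotZl.
Qed.

Lemma frame_volume_frame (x : 'I_7 -> V) : orthonormal_frame g x ->
  `|frame_volume x| = 1.
Proof.
move=> ox; pose X : 'M[R]_7 := \matrix_(i, j) g (x i) (e j).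
have XX : X *m X^T = 1%:M.
  apply/matrixP => i j; rewrite !mxE -(ox i j) (frame_parseval _ _ dV oe).
  by apply: eq_bigr => k _; rewrite !mxE.
have : \det X ^+ 2 = 1 by rewrite expr2 -{2}det_tr -det_mulmx XX det1.
move=> /eqP; rewrite sqrf_eq1 /frame_volume -/X => /orP[] /eqP ->.
  exact: normr1.
by rewrite normrN normr1.
Qed.

Lemma frame_volume1 : frame_volume e = 1.
Proof.
rewrite /frame_volume (_ : \matrix_(i, j) _ = 1%:M) ?det1 //.
by apply/matrixP => i j; rewrite !mxE oe.
Qed.

Lemma det_frame_volume (u : seq nat) (x : 'I_7 -> V) :
  size u = 7%N -> all (ltn^~ 7%N) u ->
  \det (\matrix_(i, j) g (x j) (E (nth 7 u i))) =
  (levi_civita 7 u)%:~R * frame_volume x.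
Proof.
move=> su al; rewrite -det_levi_civita // /frame_volume -[X in _ * X]det_tr -det_mulmx.
congr (\det _); apply/matrixP => i j; rewrite !mxE.
have si : (i < size u)%N by rewrite su.
have ln : (nth 7 u i < 7)%N by apply: (allP al); apply: mem_nth.
rewrite (bigD1 (Ordinal ln)) //= !mxE eqxx mul1r big1 ?addr0 => [|k nk].
  by congr (g _ (e _)); apply: val_inj; rewrite /= inordK.
rewrite !mxE; suff /negPf -> : nth 7 u i != k by rewrite mul0r.
by rewrite eq_sym.
Qed.

Lemma g2_modelE x : g2_model x = tri g2_model (x ord0) (x (inord 1)) (x ord_max).
Proof. exact: triE. Qed.

Lemma tri_g2_model u v w : tri g2_model u v w = \sum_(t <- g2_terms) t.1%:~R *
  (g u (E (nth 0 t.2 0)) * g v (E (nth 0 t.2 1)) * g w (E (nth 0 t.2 2))).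
Proof.
by apply: eq_bigr => t _; rewrite !big_ord_recl big_ord0 /= mulr1 !mulrA.
Qed.

Lemma g2_model_form : is_form g2_model.
Proof.
split=> [x i c u v|x i j nij xij] /=.
  rewrite mulr_sumr -big_split /=; apply: eq_bigr => t _.
  have M := scalar_prod_multilinear (c := fun i u => g u (E (nth 0 t.2 i))).
  by rewrite M => [|l a y z] /=; rewrite ?dotDl ?dotZl // mulrDr mulrCA.
have z u w : [/\ tri g2_model u u w = 0, tri g2_model u w u = 0 & tri g2_model w u u = 0].
  rewrite !tri_g2_model /g2_terms /= !big_cons !big_nil /=; split; ring.
have c3 (k : 'I_3) : [\/ k = ord0, k = inord 1 | k = ord_max].
  case: k => -[|[|[|//]]] lk.
  - by constructor 1; apply: val_inj.
  - by constructor 2; apply: val_inj; rewrite /= inordK.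
  - by constructor 3; apply: val_inj.
rewrite g2_modelE; case: (c3 i) nij xij => ->; case: (c3 j) => ->; rewrite ?eqxx // => _.
- by move=> ->; case: (z (x (inord 1)) (x ord_max)).
- by move=> ->; case: (z (x ord_max) (x (inord 1))).
- by move=> <-; case: (z (x (inord 1)) (x ord_max)).
- by move=> ->; case: (z (x ord_max) (x ord0)).
- by move=> <-; case: (z (x ord_max) (x (inord 1))).
- by move=> ->; case: (z (x (inord 1)) (x ord0)).
Qed.

(** Each triple of monomials antisymmetrizes to a Levi-Civita sign times the volume. Collecting by
    the indices paired with v and w gives [g2_gram], which is 144 times the identity; the
    normalization 2! 2! 3! = 24 leaves 6. *)
Lemma g2_model_wedge v w x :
  wedge (wedge (interior v g2_model) (interior w g2_model)) g2_model x =
  6 * (g v w * frame_volume x).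
Proof.
rewrite (@wedge_wedge R V 2 2 3).
have -> : altsum (fun y : 'I_(2 + 2 + 3) -> V =>
    interior v g2_model (fun i => y (lshift 3 (lshift 2 i))) *
    interior w g2_model (fun i => y (lshift 3 (rshift 2 i))) *
    g2_model (fun i => y (rshift (2 + 2) i))) x =
  \sum_(t <- g2_terms) \sum_(t' <- g2_terms) \sum_(t'' <- g2_terms)
    (t.1 * t'.1 * t''.1 * levi_civita 7 (behead t.2 ++ behead t'.2 ++ t''.2))%:~R *
    g w (E (head 0 t'.2)) * g v (E (head 0 t.2)) * frame_volume x.
  transitivity (altsum (fun y : 'I_(2 + 2 + 3) -> V =>
    \sum_(t <- g2_terms) \sum_(t' <- g2_terms) \sum_(t'' <- g2_terms)
      (t.1 * t'.1 * t''.1)%:~R * g w (E (head 0 t'.2)) * g v (E (head 0 t.2)) *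
      \prod_i g (y i) (E (nth 7 (behead t.2 ++ behead t'.2 ++ t''.2) i))) x).
    congr (altsum _ x); apply: funext => y.
    rewrite !tri_interior [X in _ * X]triE !tri_g2_model.
    have ix (i : 'I_7) k : i = k :> nat -> i = inord k by move=> <-; rewrite inord_val.
    rewrite (ix (lshift 3 (lshift 2 (ord0 : 'I_2))) 0%N) // (ix (lshift 3 (lshift 2 (ord_max : 'I_2))) 1%N) //.
    rewrite (ix (lshift 3 (rshift 2 (ord0 : 'I_2))) 2%N) // (ix (lshift 3 (rshift 2 (ord_max : 'I_2))) 3%N) //.
    rewrite (ix (rshift (2 + 2) (ord0 : 'I_3)) 4%N) // (ix (rshift (2 + 2) (ord_max : 'I_3)) 6%N) //.
    rewrite (ix (rshift (2 + 2) (inord 1 : 'I_3)) 5%N) /= ?inordK //.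
    rewrite !mulr_suml; apply: eq_big_seq => t /g2_terms_shape[[[a b] c] [-> _]].
    rewrite -mulrA mulrCA mulr_suml; apply: eq_big_seq => t' /g2_terms_shape[[[a' b'] c'] [-> _]].
    rewrite mulrA mulr_sumr; apply: eq_big_seq => t'' /g2_terms_shape[[[a'' b''] c''] [-> _]].
    by rewrite prod_ord7 !inordK //= !rmorphM /=; ring.
  rewrite altsum_sum; apply: eq_big_seq => t /g2_terms_shape[[[a b] c] [-> [a7 b7 c7]]].
  rewrite altsum_sum; apply: eq_big_seq => t' /g2_terms_shape[[[a' b'] c'] [-> [a7' b7' c7']]].
  rewrite altsum_sum; apply: eq_big_seq => t'' /g2_terms_shape[[[a'' b''] c''] [-> [a7'' b7'' c7'']]].
  rewrite altsumZ.
  rewrite (altsum_prod (fun i u => g u (E (nth 7 (behead [:: a; b; c] ++ behead [:: a'; b'; c'] ++ [:: a''; b''; c'']) i)))).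
  rewrite det_frame_volume //=; last by rewrite b7 c7 b7' c7' a7'' b7'' c7''.
  by rewrite [in RHS]rmorphM /=; ring.
have hd t : t \in g2_terms -> (head 0 t.2 < 7)%N.
  by case/g2_terms_shape => [[[a b] c] [-> []]].
transitivity (((2`! * 2`! * 3`!)%N%:R)^-1 * (\sum_(a < 7) \sum_(b < 7)
   (g2_gram a b)%:~R * g w (E b) * g v (E a)) * frame_volume x).
  rewrite -mulrA; congr (_ * _).
  transitivity ((\sum_(t <- g2_terms) (\sum_(b < 7) (\sum_(t' <- [seq t' <- g2_terms | head 0%N t'.2 == b])
     \sum_(t'' <- g2_terms)
    (t.1 * t'.1 * t''.1 * levi_civita 7 (behead t.2 ++ behead t'.2 ++ t''.2))%:~R) * g w (E b))
     * g v (E (head 0 t.2))) * frame_volume x).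
    rewrite mulr_suml; apply: eq_bigr => t _.
    rewrite -(sum_by_index _ (fun b => g w (E b))); last by apply/allP => t' /hd.
    rewrite !mulr_suml; apply: eq_bigr => t' _; rewrite !mulr_suml; apply: eq_bigr => t'' _.
    by [].
  congr (_ * _).
  rewrite (sum_by_index (h := fun t => head 0 t.2) (m := 7) _ (fun a => g v (E a))); last by apply/allP => t' /hd.
  apply: eq_bigr => a _; rewrite exchange_big mulr_suml; apply: eq_bigr => b _.
  rewrite -mulr_suml; congr (_ * _ * _); rewrite /g2_gram isumE.
  by apply: eq_bigr => t _; rewrite isumE; apply: eq_bigr => t' _; rewrite isumE.
have -> : \sum_(a < 7) \sum_(b < 7) (g2_gram a b)%:~R * g w (E b) * g v (E a) = 144%:R * g v w.
  rewrite (frame_parseval v w dV oe) mulr_sumr; apply: eq_bigr => a _.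
  rewrite (bigD1 a) //= big1 ?addr0 => [|b nb].
    by rewrite g2_gramE // eqxx inord_val -mulrA [g w _ * _]mulrC.
  by rewrite g2_gramE // ifN ?mul0r // eq_sym.
by rewrite (_ : (2`! * 2`! * 3`!)%N = 24%N) //; field.
Qed.

Lemma g2_model_induces : g2_induces g2_model g frame_volume.
Proof.
split; first by split; [exact: frame_volume_form | exact: frame_volume_frame].
by move=> v w x; rewrite g2_model_wedge [RHS]mulrA mulVf ?mul1r // pnatr_eq0.
Qed.

Lemma g2_model_is_g2 : is_g2_structure g2_model.
Proof.
split; first exact: g2_model_form.
move=> v v0; exists e; rewrite g2_model_wedge frame_volume1 mulr1.
by rewrite mulf_neq0 ?pnatr_eq0 // gt_eqF // dot_gt0.
Qed.

End Model.

(** * The differential of the Hodge dual of the model *)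

Section AltsumRec.
Variables (R : realType) (V : vectType R).

Lemma lift_perm_bij k :
  bijective (fun p : 'I_k.+1 * 'S_k => lift_perm ord0 p.1 p.2 : 'S_k.+1).
Proof.
apply: inj_card_bij; last first.
  by rewrite card_prod card_ord !card_Sn factS.
move=> [i s] [j t] /= E; have ij : i = j.
  by have := congr1 (fun u : 'S_k.+1 => u ord0) E; rewrite /= !lift_perm_id.
rewrite -{j}ij in E *; congr (_, _); apply/permP => l; apply: (@lift_inj _ i).
by have := congr1 (fun u : 'S_k.+1 => u (lift ord0 l)) E; rewrite /= !lift_perm_lift.
Qed.

(** Permutations are split by their value at 0, as in the Laplace expansion; applied twice, this
    produces the pairs of arguments that enter the bracket in the Chevalley-Eilenberg formula. *)
Lemma altsum_recl k (F : ('I_k.+1 -> V) -> R) x :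
  altsum F x = \sum_(i < k.+1) (-1) ^+ i *
    altsum (fun y => F (vcons (x i) y)) (fun l => x (lift i l)).
Proof.
rewrite /altsum (reindex _ (onW_bij _ (lift_perm_bij k))) /=.
under [RHS]eq_bigr do rewrite mulr_sumr.
rewrite pair_big /=; apply: eq_bigr => -[i s] _ /=; rewrite mulrA; congr (_ * _).
  by rewrite odd_lift_perm /= signr_addb -[in RHS]signr_odd.
congr F; rewrite [LHS]vcons_eta lift_perm_id; congr (vcons _ _).
by apply: funext => l; rewrite lift_perm_lift.
Qed.

(** By sorting and alternation only strictly increasing index lists matter: 21 of them for a 5-form
    in dimension 7. *)
Lemma form_ext_sorted k n (b : ('I_k -> V) -> R) (e : 'I_n.+1 -> V) :
  is_form b ->
  (forall s : seq nat, size s = k -> all (ltn^~ n.+1) s -> sorted ltn s ->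
     b (vtup k [seq e (inord i) | i <- s]) = 0) ->
  forall f : 'I_k -> 'I_n.+1, b (fun i => e (f i)) = 0.
Proof.
move=> fb H f; case: (boolP (injectiveb f)) => [/injectiveP fI|]; last exact: (form_noninj e fb).
pose t := [tuple val (f i) | i < k].
have ps : perm_eq (sort leq t) t by rewrite perm_sort.
have [p pE] := tuple_permP ps.
have : b (fun i => e (f (p i))) = 0.
  have -> : (fun i => e (f (p i))) = vtup k [seq e (inord i) | i <- sort leq t].
    apply: funext => i; rewrite /vtup pE /= (nth_map 0%N); last first.
      by rewrite size_map size_enum_ord.
    by rewrite (nth_map i) ?size_enum_ord // nth_ord_enum tnth_mktuple inord_val.
  apply: H.
  - by rewrite size_sort size_tuple.
  - apply/allP => j; rewrite mem_sort => /tnthP[i ->]; rewrite tnth_mktuple; exact: ltn_ord.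
  - rewrite ltn_sorted_uniq_leq sort_uniq sort_sorted ?andbT; last exact: leq_total.
    by rewrite map_inj_uniq ?enum_uniq // => i j /val_inj/fI.
rewrite (form_perm (fun i => e (f i)) p fb) => /eqP.
by rewrite mulf_eq0 signr_eq0 => /eqP.
Qed.

End AltsumRec.

Section DifferentialForm.
Variables (R : realType) (n : vectType R) (br : {bilinear n -> n -> n}).
Hypothesis hlie : is_lie_bracket br.
Variable a : ('I_4 -> n) -> R.
Hypothesis fa : is_form a.

Let G (x : 'I_5 -> n) :=
  a (vcons (br (x ord0) (x (lift ord0 ord0))) (fun l => x (lift ord0 (lift ord0 l)))).

Lemma contract_bracket_multilinear : multilinear G.
Proof.
move=> x i c u v /=; have [ma _] := fa.
have out j w : (forall l : 'I_3, lift ord0 (lift ord0 l) != j :> 'I_5) ->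
    (fun l : 'I_3 => @dfwith _ (fun=> n) x j w (lift ord0 (lift ord0 l))) =
    (fun l => x (lift ord0 (lift ord0 l))).
  exact: (dfwith_comp_out x w (h := fun l : 'I_3 => lift ord0 (lift ord0 l))).
have inj0 : injective (fun l : 'I_3 => lift ord0 (lift ord0 l) : 'I_5).
  by move=> l l' /lift_inj/lift_inj.
case: (unliftP ord0 i) => [i'|] ->; last first.
  have E w : G (@dfwith _ (fun=> n) x ord0 w) = a (vcons (br w (x (lift ord0 ord0)))
      (fun l => x (lift ord0 (lift ord0 l)))).
    by rewrite /G dfwith_in dfwith_out ?neq_lift // out.
  by rewrite !E bracketDl bracketZl (scalar_vcons _ ma).
case: (unliftP ord0 i') => [l|] ->; last first.
  have E w : G (@dfwith _ (fun=> n) x (lift ord0 ord0) w) = a (vcons (br (x ord0) w)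
      (fun l => x (lift ord0 (lift ord0 l)))).
    by rewrite /G dfwith_out 1?eq_sym ?neq_lift // dfwith_in out.
  by rewrite !E bracketDr bracketZr (scalar_vcons _ ma).
have E w : G (@dfwith _ (fun=> n) x (lift ord0 (lift ord0 l)) w) =
    a (vcons (br (x ord0) (x (lift ord0 ord0)))
      (@dfwith _ (fun=> n) (fun l => x (lift ord0 (lift ord0 l))) l w)).
  rewrite /G dfwith_out 1?eq_sym ?neq_lift // dfwith_out; last first.
    by rewrite (inj_eq lift_inj) eq_sym neq_lift.
  by rewrite (dfwith_comp x l w inj0).
by rewrite !E (multilinear_vcons _ ma).
Qed.

(** The 12 is twice 3!: each bracket occurs in both orders, and the three other arguments in 3!
    orders of equal signed value. Alternation of the differential follows. *)
Lemma ce_diff_altsum x : ce_diff br a x = - 12%:R^-1 * altsum G x.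
Proof.
have xE : x = vtup 5 [:: x (inord 0); x (inord 1); x (inord 2); x (inord 3); x (inord 4)].
  apply: funext => i; rewrite -[in LHS](inord_val i).
  by case: i => -[|[|[|[|[|//]]]]] li.
have -> : altsum G x = \sum_(i < 5) (-1) ^+ i * \sum_(j < 4) (-1) ^+ j *
    (6%:R * a (vcons (br (x i) (x (lift i j))) (fun l => x (lift i (lift j l))))).
  rewrite altsum_recl; apply: eq_bigr => i _; congr (_ * _).
  rewrite altsum_recl; apply: eq_bigr => j _; congr (_ * _).
  have fr : is_form (fun y => a (vcons (br (x i) (x (lift i j))) y)).
    have [ma al] := fa; split; first exact: multilinear_vcons.
    move=> y l m lm ylm; apply: (al _ (lift ord0 l) (lift ord0 m)).
      by rewrite (inj_eq lift_inj).
    by rewrite /vcons !liftK.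
  rewrite -[6%:R]/(3`!%:R) -(form_antisym_sum _ fr); congr (altsum _ _).
  apply: funext => y; rewrite /G /vcons; congr a; apply: funext => m.
  case: unliftP => [m'|] //=; first by rewrite !liftK.
  by move=> _; rewrite unlift_none liftK unlift_none.
have anti u v y : a (vcons (br v u) y) = - a (vcons (br u v) y).
  have sc := scalar_vcons y fa.1.
  by rewrite (bracket_antisym hlie u v) -scaleN1r (scalar_scale _ _ sc) mulN1r.
rewrite xE; set s := [:: _; _; _; _; _].
have E (i : 'I_5) (j : 'I_4) :
    vcons (br (vtup 5 s i) (vtup 5 s (lift i j)))
          (fun l => vtup 5 s (lift i (lift j l))) =
    vcons (br s`_i s`_(bump i j)) (vtup 3 [seq s`_(bump i (bump j l)) | l <- iota 0 3]).
  congr (vcons _ _); apply: funext => l.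
  by rewrite /vtup (nth_map 0%N) ?size_iota ?nth_iota ?add0n.
under [in RHS]eq_bigr do under eq_bigr do rewrite E.
rewrite ce_diff4 !big_ord_recl !big_ord0 /= /bump /= !vtup_cons.
move: (x _) (x _) (x _) (x _) (x _) => x0 x1 x2 x3 x4.
rewrite (anti x0 x1) (anti x0 x2) (anti x0 x3) (anti x0 x4) (anti x1 x2) (anti x1 x3).
rewrite (anti x1 x4) (anti x2 x3) (anti x2 x4) (anti x3 x4).
by rewrite !exprS !expr0; field.
Qed.

Lemma ce_diff_form : is_form (ce_diff br a).
Proof.
have -> : ce_diff br a = fun x => - 12%:R^-1 * altsum G x.
  by apply: funext => x; apply: ce_diff_altsum.
have [mG aG] := altsum_form contract_bracket_multilinear.
split=> [x i c u v|x i j ij xij] /=; last by rewrite (aG _ i j) // mulr0.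
by rewrite mG; ring.
Qed.

End DifferentialForm.

(* Six times a component of the Hodge dual of the model. *)
Definition g2_dual (J : seq nat) : int :=
  isum (fun t : int * seq nat => t.1 * levi_civita 7 (t.2 ++ J)) g2_terms.

(* The atom (p, a, b) stands for the structure constant g([e_a, e_b], e_p). *)
Notation atom := (nat * nat * nat)%type.
Notation combination := (seq (int * atom)).

Definition bracket_terms (s : int) (a b : nat) (r : seq nat) : combination :=
  [seq (s * g2_dual (p :: r), (p, a, b)) | p <- iota 0 7].

(* Six times (d * phi)(e_x0, ..., e_x4). *)
Definition ce_diff_terms (x0 x1 x2 x3 x4 : nat) : combination :=
  bracket_terms (-1) x0 x1 [:: x2; x3; x4] ++ bracket_terms 1 x0 x2 [:: x1; x3; x4] ++
  bracket_terms (-1) x0 x3 [:: x1; x2; x4] ++ bracket_terms 1 x0 x4 [:: x1; x2; x3] ++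
  bracket_terms (-1) x1 x2 [:: x0; x3; x4] ++ bracket_terms 1 x1 x3 [:: x0; x2; x4] ++
  bracket_terms (-1) x1 x4 [:: x0; x2; x3] ++ bracket_terms (-1) x2 x3 [:: x0; x1; x4] ++
  bracket_terms 1 x2 x4 [:: x0; x1; x3] ++ bracket_terms (-1) x3 x4 [:: x0; x1; x2].

(** [rep] expresses a structure constant through those taken as independent. It is applied once, so
    the check relies on right-hand sides that are already reduced. *)
Definition substitute (rep : atom -> combination) (L : combination) : combination :=
  flatten [seq [seq (q.1 * q'.1, q'.2) | q' <- rep q.2] | q <- L & q.1 != 0].

Definition vanishing (L : combination) : bool :=
  all (fun x => isum (fun q : int * atom => if q.2 == x then q.1 else 0) L == 0)
      (undup (map snd L)).

(** Ranges over increasing quintuples: [iota x.+1 (6 - x)] lists x + 1, ..., 6. *)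
Definition coclosed_check (rep : atom -> combination) : bool :=
  all (fun x0 => all (fun x1 => all (fun x2 => all (fun x3 => all (fun x4 =>
    vanishing (substitute rep (ce_diff_terms x0 x1 x2 x3 x4)))
    (iota x3.+1 (6 - x3))) (iota x2.+1 (6 - x2))) (iota x1.+1 (6 - x1)))
    (iota x0.+1 (6 - x0))) (iota 0 7).

Section Evaluation.
Variables (R : nzRingType) (c : atom -> R).

Definition evaluate (L : combination) : R := \sum_(q <- L) q.1%:~R * c q.2.

Lemma evaluate_cat L L' : evaluate (L ++ L') = evaluate L + evaluate L'.
Proof. exact: big_cat. Qed.

Lemma evaluate_vanishing L : vanishing L -> evaluate L = 0.
Proof.
move=> /allP vL; rewrite /evaluate.
transitivity (\sum_(q <- L) \sum_(x <- undup (map snd L)) (if q.2 == x then q.1 else 0)%:~R * c x).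
  apply: eq_big_seq => q qL.
  rewrite (bigD1_seq q.2) ?undup_uniq ?mem_undup ?map_f //= eqxx big1 ?addr0 //.
  by move=> x; rewrite eq_sym => /negPf ->; rewrite mul0r.
rewrite exchange_big big_seq big1 //= => x /vL /eqP H.
by rewrite -mulr_suml -isumE H mul0r.
Qed.

Lemma evaluate_substitute rep L :
  (forall x, x \in map snd L -> c x = evaluate (rep x)) -> evaluate (substitute rep L) = evaluate L.
Proof.
rewrite /substitute; elim: L => [|q L IH] H //=.
rewrite [in RHS]/evaluate big_cons -/(evaluate L) -IH => [|x xL]; last first.
  by apply: H; rewrite inE xL orbT.
case: eqVneq => [->|_] /=; first by rewrite mul0r add0r.
rewrite evaluate_cat; congr (_ + _); rewrite /evaluate big_map H ?inE ?eqxx //.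
by rewrite mulr_sumr; apply: eq_bigr => q' _ /=; rewrite intrM mulrA.
Qed.

End Evaluation.

Section CoclosedModel.
Variables (R : realType) (n : vectType R) (br : {bilinear n -> n -> n}).
Hypothesis hlie : is_lie_bracket br.
Variable g : {dot n for idfun}.
Hypothesis dn : \dim {:n} = 7%N.
Variable e : 'I_7 -> n.
Hypothesis oe : orthonormal_frame g e.
Local Notation E i := (e (inord i%N)).
Local Notation vol := (frame_volume g e).
Local Notation phi := (g2_model g e).
Local Notation psi := (@hodge R n g 3 4 vol phi).

Lemma hodge_model_form : is_form psi.
Proof.
apply: (hodge_form (k := 3) (m := 4) dn oe).
  exact: frame_volume_form.
exact: g2_model_form.
Qed.

Lemma hodge_model (J : seq nat) : size J = 4%N -> all (ltn^~ 7%N) J ->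
  psi (vtup 4 [seq E i | i <- J]) = 6%:R^-1 * (g2_dual J)%:~R.
Proof.
move=> sJ aJ; have fvol := frame_volume_form g e; have fphi := g2_model_form g e.
rewrite (hodge_frame (k := 3) (m := 4) dn oe fvol fphi); congr (_ * _).
rewrite /g2_dual isumE.
transitivity (\sum_(t <- g2_terms) \sum_(I : {ffun 'I_3 -> 'I_7})
  t.1%:~R * (\prod_(i < 3) g (e (I i)) (E (nth 0 t.2 i))) *
  vol (vcat (fun l => e (I l)) (vtup 4 [seq E i | i <- J]))).
  by rewrite exchange_big; apply: eq_bigr => I _; rewrite mulr_suml.
apply: eq_big_seq => t /g2_terms_shape[[[a b] c] [-> [a7 b7 c7]]].
pose I0 : {ffun 'I_3 -> 'I_7} := [ffun i : 'I_3 => inord (nth 0%N [:: a; b; c] i)].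
rewrite (bigD1 I0) //= [X in _ + X]big1 ?addr0 => [|I nI]; last first.
  have /forallPn[i ni] : ~~ [forall i, I i == I0 i].
    by apply: contra nI => /forallP h; apply/eqP/ffunP => i; apply/eqP.
  by rewrite (bigD1 i) //= oe; rewrite ffunE in ni; rewrite (negPf ni) mul0r mulr0 mul0r.
rewrite big1 ?mulr1 => [|i _]; last by rewrite ffunE oe eqxx.
rewrite rmorphM /=; congr (_ * _).
have -> : (fun l : 'I_3 => e (I0 l)) = vtup 3 [seq E i | i <- [:: a; b; c]].
  by apply: funext => -[[|[|[|//]]] li]; rewrite ffunE.
rewrite vcat_vtup // -map_cat (volume_levi_civita fvol (fun i => E i)).
- have -> : (fun i : 'I_7 => E i) = e by apply: funext => i; rewrite inord_val.
  by rewrite frame_volume1 // mulr1.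
- by rewrite size_cat sJ.
- by rewrite all_cat aJ /= a7 b7 c7.
Qed.

Let c (x : atom) : R := let: (p, a, b) := x in g (br (E a) (E b)) (E p).

Lemma hodge_bracket (s : int) a b (r : seq nat) : size r = 3%N -> all (ltn^~ 7%N) r ->
  evaluate c (bracket_terms s a b r) =
  s%:~R * (6%:R * psi (vtup 4 (br (E a) (E b) :: [seq E i | i <- r]))).
Proof.
move=> sr ar; rewrite vtup_cons (frame_expand (br _ _) dn oe).
have sc := scalar_vcons (vtup 3 [seq E i | i <- r]) hodge_model_form.1.
have -> : psi (vcons (\sum_j g (br (E a) (E b)) (e j) *: e j) (vtup 3 [seq E i | i <- r])) =
    \sum_j g (br (E a) (E b)) (e j) * psi (vcons (e j) (vtup 3 [seq E i | i <- r])).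
  by rewrite (scalar_sum sc); apply: eq_bigr => j _; rewrite (scalar_scale _ _ sc).
rewrite /evaluate big_map -[7%N]/(7 - 0)%N -/(index_iota 0 7) big_mkord mulr_sumr mulr_sumr.
apply: eq_bigr => p _; rewrite intrM -mulrA; congr (_ * _).
have := hodge_model (J := (p : nat) :: r); rewrite /= sr ar ltn_ord inord_val.
move=> /(_ erefl erefl); rewrite vtup_cons => ->.
by rewrite mulrCA mulVKf ?pnatr_eq0 // mulrC.
Qed.

Lemma bracket_terms_bound (s : int) a b r : (a < 7)%N -> (b < 7)%N ->
  all (fun x : atom => (x.1.1 < 7) && (x.1.2 < 7) && (x.2 < 7))%N (map snd (bracket_terms s a b r)).
Proof. by move=> a7 b7; rewrite /= a7 b7. Qed.

(** Soundness of the integer check: the second hypothesis says that the relations encoded in [rep]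
    hold for this bracket and frame. Multilinearity and alternation reduce d psi = 0 to the
    quintuples checked. *)
Lemma model_coclosed (rep : atom -> combination) : coclosed_check rep ->
  (forall p a b, (p < 7)%N -> (a < 7)%N -> (b < 7)%N ->
     c (p, a, b) = evaluate c (rep (p, a, b))) ->
  is_coclosed_g2 br phi.
Proof.
move=> chk repE; split; first exact: g2_model_is_g2.
exists g, vol; split; first exact: g2_model_induces.
have fd := ce_diff_form hlie hodge_model_form.
have z : forall f : 'I_5 -> 'I_7, ce_diff br psi (fun i => e (f i)) = 0.
  apply: (form_ext_sorted fd) => s ss al so.
  case: s ss al so => [|x0 [|x1 [|x2 [|x3 [|x4 [|]]]]]] //= _ al so.
  have [h0 [h1 [h2 [h3 h4]]]] : (x0 < 7 /\ x0 < x1 < 7 /\ x1 < x2 < 7 /\ x2 < x3 < 7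
    /\ x3 < x4 < 7)%N by lia.
  have V : vanishing (substitute rep (ce_diff_terms x0 x1 x2 x3 x4)).
    move: chk => /allP/(_ x0); rewrite mem_iota => /(_ h0).
    move=> /allP/(_ x1); rewrite mem_iota => /(_ ltac:(lia)).
    move=> /allP/(_ x2); rewrite mem_iota => /(_ ltac:(lia)).
    move=> /allP/(_ x3); rewrite mem_iota => /(_ ltac:(lia)).
    by move=> /allP/(_ x4); rewrite mem_iota => /(_ ltac:(lia)).
  have := evaluate_vanishing c V; rewrite evaluate_substitute; last first.
    move=> [[p a] b] H.
    have : all (fun x : atom => (x.1.1 < 7) && (x.1.2 < 7) && (x.2 < 7))%N
      (map snd (ce_diff_terms x0 x1 x2 x3 x4)).
      by rewrite !map_cat !all_cat !bracket_terms_bound //; lia.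
    by move=> /allP/(_ _ H) /= /andP[/andP[p7 a7] b7]; apply: repE.
  rewrite /ce_diff_terms !evaluate_cat !hodge_bracket //=; try lia.
  have six : 6%:R != 0 :> R by rewrite pnatr_eq0.
  move=> H; apply: (mulfI six); rewrite mulr0 -[RHS]H ce_diff4 !rmorphN1 rmorph1; ring.
move=> x; have -> : x = fun i => \sum_j g (x i) (e j) *: e j.
  by apply: funext => i; apply: frame_expand.
rewrite (multilinear_expand _ _ fd.1) big1 // => f _.
by rewrite z mulr0.
Qed.

End CoclosedModel.

(** * Structure constants of adapted frames *)

Definition antisym_rep (base : atom -> combination) (x : atom) : combination :=
  let: (p, a, b) := x in
  if (a < b)%N then base (p, a, b)
  else if (b < a)%N then [seq (- q.1, q.2) | q <- base (p, b, a)] else [::].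

(** Atoms outside the table stand for themselves. *)
Definition table_rep (T : seq (atom * combination)) (x : atom) : combination :=
  head [:: (1, x)] [seq y.2 | y <- T & y.1 == x].

(** Encodes that the first m frame vectors are central and that their span contains D: [e_a, e_b]
    vanishes for a < m and has no component p >= m. Under [antisym_rep] only a < b is queried, which
    bounds b as well. *)
Definition block_rep (m : nat) (T : seq (atom * combination)) (x : atom) : combination :=
  if ((x.1.1 < m) && (m <= x.1.2))%N then table_rep T x else [::].

(* With s_0 = e^34 + e^56, s_1 = e^35 - e^46, s_2 = - e^36 - e^45 and
   w_p = g([-, -], e_p), the conditions <w_p, s_q> = <w_q, s_p> solved for three
   structure constants. *)
Definition center_table : seq (atom * combination) :=
  [:: ((1, 5, 6)%N, [:: (1, (0, 3, 5)%N); (-1, (0, 4, 6)%N); (-1, (1, 3, 4)%N)]);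
      ((2, 5, 6)%N, [:: (-1, (0, 3, 6)%N); (-1, (0, 4, 5)%N); (-1, (2, 3, 4)%N)]);
      ((2, 4, 6)%N, [:: (1, (2, 3, 5)%N); (1, (1, 3, 6)%N); (1, (1, 4, 5)%N)])].

(* Invariance of w_0 under the complex structure e_1 -> e_2, e_3 -> e_4, e_5 -> e_6. *)
Definition line_table : seq (atom * combination) :=
  [:: ((0, 2, 4)%N, [:: (1, (0, 1, 3)%N)]); ((0, 2, 3)%N, [:: (-1, (0, 1, 4)%N)]);
      ((0, 2, 6)%N, [:: (1, (0, 1, 5)%N)]); ((0, 2, 5)%N, [:: (-1, (0, 1, 6)%N)]);
      ((0, 4, 6)%N, [:: (1, (0, 3, 5)%N)]); ((0, 4, 5)%N, [:: (-1, (0, 3, 6)%N)])].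

Lemma center_table_check : coclosed_check (antisym_rep (block_rep 3 center_table)).
Proof. vm_compute. reflexivity. Qed.

Lemma line_table_check : coclosed_check (antisym_rep (block_rep 1 line_table)).
Proof. vm_compute. reflexivity. Qed.

Lemma evaluate_table (R : nzRingType) (c : atom -> R) T x :
  (forall y, y \in T -> c y.1 = evaluate c y.2) -> c x = evaluate c (table_rep T x).
Proof.
rewrite /table_rep; elim: T => [|y T IH] H /=.
  by rewrite /evaluate big_seq1 mul1r.
case: eqVneq => [<-|_] /=; first by apply: H; rewrite mem_head.
by apply: IH => z zT; apply: H; rewrite inE zT orbT.
Qed.

Section CoclosedBlock.
Variables (R : realType) (n : vectType R) (br : {bilinear n -> n -> n}).
Hypothesis hlie : is_lie_bracket br.
Variable g : {dot n for idfun}.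
Hypothesis dn : \dim {:n} = 7%N.
Variable e : 'I_7 -> n.
Hypothesis oe : orthonormal_frame g e.
Local Notation E i := (e (inord i%N)).
Let c (x : atom) : R := let: (p, a, b) := x in g (br (E a) (E b)) (E p).

Lemma block_coclosed (m : nat) (T : seq (atom * combination)) :
  coclosed_check (antisym_rep (block_rep m T)) ->
  (forall i x, (i < m)%N -> br (E i) x = 0) ->
  (forall i x y, (m <= i < 7)%N -> g (br x y) (E i) = 0) ->
  (forall y, y \in T -> c y.1 = evaluate c y.2) ->
  is_coclosed_g2 br (g2_model g e).
Proof.
move=> chk cen der tab; apply: (model_coclosed hlie dn oe chk) => p a b p7 a7 b7.
have base a' b' : (a' < b' < 7)%N -> c (p, a', b') = evaluate c (block_rep m T (p, a', b')).
  move=> ab; rewrite /block_rep /=; case: ltnP => /= pm; last first.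
    by rewrite der ?pm // /evaluate big_nil.
  case: leqP => am; first exact: evaluate_table.
  by rewrite cen // dot0l /evaluate big_nil.
rewrite /antisym_rep; case: ltngtP => ab.
- by apply: base; rewrite ab.
- rewrite bracket_antisym // dotNl -[g _ _]/(c (p, b, a)) base ?ab //.
  by rewrite /evaluate big_map -sumrN; apply: eq_bigr => q _; rewrite rmorphN mulNr.
- by rewrite ab; case: hlie => -> _; rewrite dot0l /evaluate big_nil.
Qed.

Lemma center_coclosed :
  (forall i x, (i < 3)%N -> br (E i) x = 0) ->
  (forall i x y, (3 <= i < 7)%N -> g (br x y) (E i) = 0) ->
  c (1, 3, 4)%N + c (1, 5, 6)%N = c (0, 3, 5)%N - c (0, 4, 6)%N ->
  c (2, 3, 4)%N + c (2, 5, 6)%N = - c (0, 3, 6)%N - c (0, 4, 5)%N ->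
  c (2, 3, 5)%N - c (2, 4, 6)%N = - c (1, 3, 6)%N - c (1, 4, 5)%N ->
  is_coclosed_g2 br (g2_model g e).
Proof.
move=> cen der r1 r2 r3; apply: (block_coclosed center_table_check cen der) => y.
rewrite !inE => /or3P[] /eqP -> /=; rewrite /evaluate !big_cons big_nil /= ?rmorphN1 ?mulr1z ?mulN1r ?mul1r.
- by rewrite -/(c (1, 5, 6)%N); lra.
- by rewrite -/(c (2, 5, 6)%N); lra.
- by rewrite -/(c (2, 4, 6)%N); lra.
Qed.

Lemma line_coclosed :
  (forall x, br (E 0) x = 0) ->
  (forall i x y, (0 < i < 7)%N -> g (br x y) (E i) = 0) ->
  c (0, 2, 4)%N = c (0, 1, 3)%N -> c (0, 2, 3)%N = - c (0, 1, 4)%N ->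
  c (0, 2, 6)%N = c (0, 1, 5)%N -> c (0, 2, 5)%N = - c (0, 1, 6)%N ->
  c (0, 4, 6)%N = c (0, 3, 5)%N -> c (0, 4, 5)%N = - c (0, 3, 6)%N ->
  is_coclosed_g2 br (g2_model g e).
Proof.
move=> cen der r1 r2 r3 r4 r5 r6.
apply: (block_coclosed line_table_check) => [[|//] x _|//|y]; first exact: cen.
rewrite !inE => /or4P[|||/or3P[]] /eqP ->; rewrite /evaluate big_seq1 ?rmorphN1 ?mulr1z ?mulN1r ?mul1r //.
Qed.

End CoclosedBlock.

(** * Frames maximizing a functional *)

Section OrthogonalMaximum.
Import numFieldNormedType.Exports.
Local Open Scope classical_set_scope.
Variables (R : realType) (m : nat).
Local Notation T := 'rV[R]_(m * m).

Lemma continuous_entry (i j : 'I_m) : continuous (fun x : T => vec_mx x i j).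
Proof.
have -> : (fun x : T => vec_mx x i j) = (fun x : T => x 0 (mxvec_index i j)).
  by apply: funext => x; rewrite mxE.
exact: coord_continuous.
Qed.

Lemma continuous_sumr (I : Type) (r : seq I) (F : I -> T -> R) :
  (forall i, continuous (F i)) -> continuous (fun x => \sum_(i <- r) F i x).
Proof. by move=> cF; apply: continuous_big => // ; exact: add_continuous. Qed.

Lemma continuous_mul (F G : T -> R) :
  continuous F -> continuous G -> continuous (fun x => F x * G x).
Proof. by move=> cF cG x; apply: continuousM; [apply: cF | apply: cG]. Qed.

(** O(m) is compact: it is the zero set of the continuous [dev], the sum of the squared entries of x
    x^T - 1, and its entries are bounded because rows are unit vectors. Matrices are flattened to
    row vectors, where boxes are compact. *)
Lemma orthogonal_max (F : 'M[R]_m -> R) : continuous (fun x : T => F (vec_mx x)) ->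
  exists2 O : 'M[R]_m, O *m O^T = 1%:M & forall P : 'M[R]_m, P *m P^T = 1%:M -> F P <= F O.
Proof.
move=> cF.
pose dev (x : T) := \sum_(i < m) \sum_(j < m)
  ((\sum_(k < m) vec_mx x i k * vec_mx x j k - (i == j)%:R) *
   (\sum_(k < m) vec_mx x i k * vec_mx x j k - (i == j)%:R)).
pose A : set T := dev @^-1` [set 0].
have AP x : A x <-> vec_mx x *m (vec_mx x)^T = 1%:M.
  split => [A0|H].
    apply/matrixP => i j; rewrite !mxE; under eq_bigr do rewrite [in X in _ * X]mxE.
    have pos i' : 0 <= \sum_(j < m)
      ((\sum_(k < m) vec_mx x i' k * vec_mx x j k - (i' == j)%:R) *
       (\sum_(k < m) vec_mx x i' k * vec_mx x j k - (i' == j)%:R)).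
      by apply: sumr_ge0 => j' _; rewrite -expr2 sqr_ge0.
    move: A0 => /= /eqP; rewrite psumr_eq0 // => /allP/(_ i (mem_index_enum _)) /=.
    rewrite psumr_eq0 => [|j' _]; last by rewrite -expr2 sqr_ge0.
    move=> /allP/(_ j (mem_index_enum _)) /=.
    by rewrite mulf_eq0 orbb subr_eq0 => /eqP.
  rewrite /A /= /dev big1 // => i _; rewrite big1 // => j _.
  have /matrixP/(_ i j) := H; rewrite !mxE; under eq_bigr do rewrite [in X in _ * X]mxE.
  by move=> ->; rewrite subrr mul0r.
have cdev : continuous dev.
  apply: continuous_sumr => i; apply: continuous_sumr => j.
  have cs : continuous (fun x : T => \sum_(k < m) vec_mx x i k * vec_mx x j k - (i == j)%:R).
    move=> x; apply: (cvgB (FF := nbhs_filter x)); last exact: cvg_cst.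
    by apply: continuous_sumr => k; apply: continuous_mul; exact: continuous_entry.
  exact: continuous_mul.
have clA : closed A by apply: preimage_closed; [move=> x _; apply: cdev | exact: closed_eq].
have box := @rV_compact R (m * m) (fun=> `[(- 1), 1]%classic)
  (fun=> @segment_compact R (- 1) 1).
have cA : compact A.
  apply: (subclosed_compact clA box) => x /AP xx i /=.
  case/mxvec_indexP: i => i j; rewrite -[x]vec_mxK mxvecE.
  have := congr1 (fun M : 'M[R]_m => M i i) xx; rewrite !mxE eqxx /=.
  rewrite (bigD1 j) //= mxE => E.
  rewrite in_itv /= -ler_norml -[_ <= 1]ler_sqr ?nnegrE // real_normK ?num_real //.
  rewrite expr1n; apply: (@le_trans _ _ (true%:R : R)) => //.
  rewrite -E !mxE -expr2 lerDl; apply: sumr_ge0 => k _.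
  by rewrite !mxE -expr2 sqr_ge0.
have A0 : A !=set0.
  by exists (mxvec 1%:M); apply/AP; rewrite mxvecK trmx1 mulmx1.
have [x xA xm] := compact_EVT_max A0 cA (continuous_subspaceT cF).
exists (vec_mx x); first by apply/AP; rewrite inE in xA.
move=> P PP; rewrite -[P]mxvecK; apply: xm; rewrite inE; apply/AP.
by rewrite mxvecK.
Qed.

End OrthogonalMaximum.

(* Maximality under rotation of a plane: the maximum over the unit circle of
   c a + s b is sqrt (a^2 + b^2). *)
Lemma rotation_critical (R : realType) (a b d : R) :
  (forall c s, c ^+ 2 + s ^+ 2 = 1 -> c * a + s * b + d <= a + d) -> b = 0.
Proof.
move=> H; apply/eqP; apply: contraT => b0.
have b2 : 0 < b ^+ 2 by rewrite exprn_even_gt0.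
have ab : 0 < a ^+ 2 + b ^+ 2 by rewrite ltr_wpDl // sqr_ge0.
pose r := Num.sqrt (a ^+ 2 + b ^+ 2).
have r0 : 0 < r by rewrite sqrtr_gt0.
have r2 : r ^+ 2 = a ^+ 2 + b ^+ 2 by rewrite sqr_sqrtr // ltW.
have cs : (a / r) ^+ 2 + (b / r) ^+ 2 = 1.
  by rewrite !expr_div_n -mulrDl -r2 divff // expf_neq0 // gt_eqF.
have := H _ _ cs; rewrite lerD2r.
have -> : a / r * a + b / r * b = r.
  have rn : r != 0 by rewrite gt_eqF.
  by apply: (mulIf rn); rewrite -[RHS]expr2 r2; field.
move=> ra; have : r ^+ 2 <= a ^+ 2 by rewrite ler_sqr ?nnegrE // ?(le_trans (ltW r0)) // ltW.
by rewrite r2 gerDl leNgt b2.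
Qed.

Section MaximalFrames.
Import numFieldNormedType.Exports.
Variables (R : realType) (V : vectType R) (g : {dot V for idfun}) (m : nat).
Variable b : 'I_m -> V.
Hypothesis ob : orthonormal_frame g b.

Definition in_span (u : V) : Prop := u = \sum_j g u (b j) *: b j.

Lemma in_span_sum (c : 'I_m -> R) : in_span (\sum_j c j *: b j).
Proof.
apply: eq_bigr => j _; congr (_ *: _).
rewrite dot_suml (bigD1 j) //= big1 ?addr0 => [|i /negPf ij].
  by rewrite dotZl ob eqxx mulr1.
by rewrite dotZl ob ij mulr0.
Qed.

Lemma in_spanD c s u v : in_span u -> in_span v -> in_span (c *: u + s *: v).
Proof.
move=> -> ->.
rewrite !scaler_sumr -big_split /=.
have -> : \sum_(i < m) (c *: (g u (b i) *: b i) + s *: (g v (b i) *: b i)) =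
  \sum_i (c * g u (b i) + s * g v (b i)) *: b i.
  by apply: eq_bigr => i _; rewrite scalerDl !scalerA.
exact: in_span_sum.
Qed.

Lemma in_span_orthogonal u v : in_span u -> (forall j, g v (b j) = 0) -> g v u = 0.
Proof. by move=> -> vb; rewrite dot_sumr big1 // => j _; rewrite dotZr vb mulr0. Qed.

(** Orthonormal frames of the span of b are its images under orthogonal matrices, so a maximum over
    O(m) is a maximum over frames. *)
Lemma max_frame (F : ('I_m -> V) -> R) :
  continuous (fun x : 'rV[R]_(m * m) => F (fun i => \sum_j vec_mx x i j *: b j)) ->
  exists e, [/\ orthonormal_frame g e, forall i, in_span (e i) &
    forall e', orthonormal_frame g e' -> (forall i, in_span (e' i)) -> F e' <= F e].
Proof.
move=> cF; pose fr (O : 'M[R]_m) i := \sum_j O i j *: b j.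
have fr_dot O i j : g (fr O i) (fr O j) = (O *m O^T) i j.
  rewrite mxE /fr dot_suml; apply: eq_bigr => k _; rewrite dotZl mxE; congr (_ * _).
  rewrite dot_sumr (bigD1 k) //= big1 ?addr0 => [|l lk]; first by rewrite dotZr ob eqxx mulr1.
  by rewrite dotZr ob eq_sym (negPf lk) mulr0.
have [O OO maxO] := orthogonal_max (F := fun O => F (fr O)) cF.
exists (fr O); split.
- by move=> i j; rewrite fr_dot OO mxE.
- by move=> i; apply: in_span_sum.
move=> e' oe' se'; pose P : 'M[R]_m := \matrix_(i, j) g (e' i) (b j).
have -> : e' = fr P.
  by apply: funext => i; rewrite {1}[e' i]se'; apply: eq_bigr => j _; rewrite mxE.
apply: maxO; apply/matrixP => i j; rewrite -fr_dot mxE -oe'.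
by congr (g _ _); rewrite [RHS]se'; apply: eq_bigr => k _; rewrite mxE.
Qed.

Definition rotate (i j : 'I_m) (c s : R) (e : 'I_m -> V) : 'I_m -> V := fun k =>
  if k == i then c *: e i + s *: e j else
  if k == j then - s *: e i + c *: e j else e k.

Lemma rotate_orthonormal i j c s e : i != j -> c ^+ 2 + s ^+ 2 = 1 ->
  orthonormal_frame g e -> orthonormal_frame g (rotate i j c s e).
Proof.
move=> ij cs oe k l; rewrite /rotate.
have ji : (j == i) = false by rewrite eq_sym (negPf ij).
have oii : g (e i) (e i) = 1 by rewrite oe eqxx.
have ojj : g (e j) (e j) = 1 by rewrite oe eqxx.
have oij : g (e i) (e j) = 0 by rewrite oe (negPf ij).
have oji : g (e j) (e i) = 0 by rewrite oe ji.
have out p : p != i -> p != j -> [/\ g (e i) (e p) = 0, g (e p) (e i) = 0,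
    g (e j) (e p) = 0 & g (e p) (e j) = 0].
  by move=> pi pj; rewrite !oe (negPf pi) (negPf pj) eq_sym (negPf pi) eq_sym (negPf pj).
have [ki|ki] := eqVneq k i; last have [kj|kj] := eqVneq k j.
all: have [li|li] := eqVneq l i; last have [lj|lj] := eqVneq l j.
- rewrite ki li ?eqxx !dotDl !dotDr !dotZl !dotZr oii ojj oij oji.
  by apply: (etrans _ cs); ring.
- by rewrite ki lj ?eqxx ?ji ?(negPf ij) !dotDl !dotDr !dotZl !dotZr oii ojj oij oji mulr0n; ring.
- have [il _ jl _] := out l li lj.
  rewrite ki ?eqxx ?(negPf li) ?(negPf lj) ?[_ == l]eq_sym ?(negPf li).
  by rewrite dotDl !dotZl il jl ?mulr0n; ring.
- by rewrite kj li ?eqxx ?ji !dotDl !dotDr !dotZl !dotZr oii ojj oij oji mulr0n; ring.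
- rewrite kj lj ?eqxx ?ji !dotDl !dotDr !dotZl !dotZr oii ojj oij oji.
  by apply: (etrans _ cs); ring.
- have [il _ jl _] := out l li lj.
  rewrite kj ?eqxx ?ji ?(negPf li) ?(negPf lj) ?[_ == l]eq_sym ?(negPf lj).
  by rewrite dotDl !dotZl il jl ?mulr0n; ring.
- have [_ il _ jl] := out k ki kj.
  by rewrite li ?eqxx ?(negPf ki) ?(negPf kj) dotDr !dotZr il jl ?mulr0n; ring.
- have [_ il _ jl] := out k ki kj.
  by rewrite lj ?eqxx ?ji ?(negPf ki) ?(negPf kj) dotDr !dotZr il jl ?mulr0n; ring.
- by rewrite oe.
Qed.

Lemma rotate_in_span i j c s e : (forall k, in_span (e k)) ->
  forall k, in_span (rotate i j c s e k).
Proof.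
move=> se k; rewrite /rotate; case: ifP => _; first exact: in_spanD.
by case: ifP => _; [exact: in_spanD | exact: se].
Qed.

End MaximalFrames.

(** * Existence of coclosed G2-structures *)

Section Existence.
Import numFieldNormedType.Exports.
Variables (R : realType) (n : vectType R) (br : {bilinear n -> n -> n}).
Hypothesis hlie : is_lie_bracket br.
Variable g : {dot n for idfun}.
Hypothesis dn : \dim {:n} = 7%N.

(* A variational form of the polar decomposition: some rotation of the frame makes
   the matrix g (S i) (e j) symmetric. *)
Lemma max_linear_frame m (b : 'I_m -> n) (S : 'I_m -> n) : orthonormal_frame g b ->
  exists e, [/\ orthonormal_frame g e, forall i, in_span g b (e i) &
    forall i j, g (S i) (e j) = g (S j) (e i)].
Proof.
move=> ob; pose F (e : 'I_m -> n) := \sum_q g (S q) (e q).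
have [|e [oe se me]] := max_frame ob (F := F).
  have -> : (fun x : 'rV[R]_(m * m) => F (fun i => \sum_j vec_mx x i j *: b j)) =
    (fun x : 'rV[R]_(m * m) => \sum_q \sum_j vec_mx x q j * g (S q) (b j)).
    apply: funext => x; apply: eq_bigr => q _; rewrite dot_sumr.
    by apply: eq_bigr => j _; rewrite dotZr.
  apply: continuous_sumr => q; apply: continuous_sumr => j.
  by apply: continuous_mul; [exact: continuous_entry | exact: cst_continuous].
exists e; split => // i j; have [->//|ij] := eqVneq i j.
apply/eqP; rewrite -subr_eq0; apply/eqP.
pose d := \sum_(q | (q != i) && (q != j)) g (S q) (e q).
have Fr f : F f = g (S i) (f i) + g (S j) (f j) + \sum_(q | (q != i) && (q != j)) g (S q) (f q).
  by rewrite /F (bigD1 i) //= (bigD1 j) 1?eq_sym //= addrA.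
(* Along the rotation, F is c a + s b + d, where b is the difference to be shown zero and d collects
   the untouched indices. *)
apply: (@rotation_critical _ (g (S i) (e i) + g (S j) (e j)) _ d) => c s cs.
have := me _ (rotate_orthonormal ij cs oe) (rotate_in_span ob i j c s se).
rewrite !Fr /rotate !eqxx [j == i]eq_sym (negPf ij).
have -> : \sum_(q | (q != i) && (q != j)) g (S q) (if q == i then c *: e i + s *: e j
    else if q == j then - s *: e i + c *: e j else e q) = d.
  by apply: eq_bigr => q /andP[/negPf -> /negPf ->].
move=> /(le_trans _); apply; rewrite !dotDr !dotZr le_eqVlt; apply/orP; left.
by apply/eqP; ring.
Qed.

(** The functional is the pairing of w with the fundamental form e^01 + e^23 + e^45. Its maximality
    is recorded one rotation plane at a time. *)
Lemma max_complex_frame (b : 'I_6 -> n) (w : n -> n -> R) : orthonormal_frame g b ->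
  (forall x, scalar (w x)) -> (forall x y, w y x = - w x y) ->
  exists e : 'I_6 -> n, [/\ orthonormal_frame g e, forall i, in_span g b (e i) &
    forall c s (i j : 'I_6), i != j -> c ^+ 2 + s ^+ 2 = 1 ->
      let f := rotate i j c s e in
      w (f (inord 0)) (f (inord 1)) + w (f (inord 2)) (f (inord 3)) + w (f (inord 4)) (f (inord 5))
      <= w (e (inord 0)) (e (inord 1)) + w (e (inord 2)) (e (inord 3)) + w (e (inord 4)) (e (inord 5))].
Proof.
move=> ob lw aw.
pose F (e : 'I_6 -> n) := w (e (inord 0)) (e (inord 1)) + w (e (inord 2)) (e (inord 3)) +
   w (e (inord 4)) (e (inord 5)).
have wsumr x c : w x (\sum_j c j *: b j) = \sum_j c j * w x (b j).
  by rewrite (scalar_sum (lw x)); apply: eq_bigr => j _; rewrite (scalar_scale _ _ (lw x)).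
have wsuml y c : w (\sum_j c j *: b j) y = \sum_j c j * w (b j) y.
  by rewrite aw wsumr -sumrN; apply: eq_bigr => j _; rewrite -mulrN -aw.
have [|e [oe se me]] := max_frame ob (F := F).
  have cw p q : continuous (fun x : 'rV[R]_(6 * 6) =>
      w (\sum_j vec_mx x p j *: b j) (\sum_j vec_mx x q j *: b j)).
    have -> : (fun x : 'rV[R]_(6 * 6) =>
      w (\sum_j vec_mx x p j *: b j) (\sum_j vec_mx x q j *: b j)) =
      (fun x => \sum_j \sum_k vec_mx x p j * (vec_mx x q k * w (b j) (b k))).
      apply: funext => x; rewrite wsuml; apply: eq_bigr => j _; rewrite wsumr mulr_sumr.
      by apply: eq_bigr => k _.
    apply: continuous_sumr => j; apply: continuous_sumr => k.
    apply: continuous_mul; first exact: continuous_entry.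
    by apply: continuous_mul; [exact: continuous_entry | exact: cst_continuous].
  move=> x; apply: (cvgD (FF := nbhs_filter x)); last exact: cw.
  by apply: (cvgD (FF := nbhs_filter x)); exact: cw.
exists e; split => // c s i j ij cs.
exact: (me _ (rotate_orthonormal ij cs oe) (rotate_in_span ob i j c s se)).
Qed.

Lemma coclosed_of_center (W : {vspace n}) : \dim W = 3%N ->
  (forall x, x \in W -> is_central br x) -> (derived_algebra br <= W)%VS ->
  exists phi, is_coclosed_g2 br phi /\ g2_metric phi g.
Proof.
move=> dW cW DW.
have [s [os sW ss]] := orthonormal_basis g W.
have sp := orthonormal_spans os sW ss; rewrite dW in ss.
have [f of_ fE] := orthonormal_frame_of os dn.
pose b (i : 'I_3) := f (inord i).
have b7 (i : 'I_3) : (i < 7)%N by apply: ltn_trans (ltn_ord i) _.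
have ob : orthonormal_frame g b.
  by move=> i j; rewrite of_ -val_eqE /= !inordK.
have bs (i : 'I_3) : b i = s`_i by rewrite /b fE inordK ?ss.
have spW x : x \in W -> in_span g b x.
  move=> xW; have := orthonormal_span os (x := x); rewrite sp => /(_ xW).
  by rewrite /in_span ss => {1}->; apply: eq_bigr => i _; rewrite bs.
have bW (i : 'I_3) : b i \in W by rewrite bs sW // mem_nth // ss.
(* Chosen so that g (S q) z = <w_z, s_q>; a frame that makes g (S p) (e q) symmetric then satisfies
   the three required relations. *)
pose S (q : 'I_3) : n := nth 0 [:: br (f (inord 3)) (f (inord 4)) + br (f (inord 5)) (f (inord 6));
   br (f (inord 3)) (f (inord 5)) - br (f (inord 4)) (f (inord 6));
   - br (f (inord 3)) (f (inord 6)) - br (f (inord 4)) (f (inord 5))] q.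
have [e [oe se sym]] := max_linear_frame S ob.
(* Only the first three vectors change, so S, built from the last four, keeps its meaning. *)
pose E (i : 'I_7) := if (i < 3)%N then e (inord i) else f i.
have bf (i : 'I_7) : (2 < i)%N -> forall j, g (f i) (b j) = 0.
  move=> i2 j; rewrite of_ -val_eqE /= inordK // gtn_eqF //.
  by apply: leq_trans i2; rewrite ltnS -ltnS.
have oE : orthonormal_frame g E.
  move=> i j; rewrite /E; case: (ltnP i 3) => i3; case: (ltnP j 3) => j3.
  - by rewrite oe -!val_eqE /= !inordK.
  - by rewrite dotC (in_span_orthogonal (se _) (bf _ _)) // -val_eqE ltn_eqF // (leq_trans i3).
  - by rewrite (in_span_orthogonal (se _) (bf _ _)) // -val_eqE gtn_eqF // (leq_trans j3).
  - exact: of_.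
have Es i : (i < 3)%N -> E (inord i) = e (inord i).
  by move=> i3; rewrite /E inordK ?i3 // (leq_trans i3).
have El i : (2 < i < 7)%N -> E (inord i) = f (inord i).
  by move=> /andP[i3 i7]; rewrite /E inordK // ltnNge i3.
have eW i : e i \in W by rewrite se; apply: memv_suml => j _; rewrite memvZ.
exists (g2_model g E); split; last by exists (frame_volume g E); apply: g2_model_induces.
apply: (center_coclosed hlie dn oE) => [i x i3|i x y i3|||].
- by rewrite Es // cW.
- rewrite El // dotC; apply: (in_span_orthogonal (b := b)).
    by apply: spW; apply: (subvP DW); apply: mem_derived.
  by apply: bf; rewrite inordK; case/andP: i3.
all: rewrite ?(Es 0%N) ?(Es 1%N) ?(Es 2%N) ?(El 3%N) ?(El 4%N) ?(El 5%N) ?(El 6%N) //.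
- have := sym (inord 0) (inord 1); rewrite /S !inordK //= dotDl !dotDl !dotNl => ->. by [].
- have := sym (inord 0) (inord 2); rewrite /S !inordK //= !dotDl !dotNl => ->. by [].
- have := sym (inord 1) (inord 2); rewrite /S !inordK //= !dotDl !dotNl => ->. by [].
Qed.

Lemma coclosed_of_line : \dim (derived_algebra br) = 1%N ->
  (forall x, x \in derived_algebra br -> is_central br x) ->
  exists phi, is_coclosed_g2 br phi /\ g2_metric phi g.
Proof.
set D := derived_algebra br => dD cD.
have [s [os sD ss]] := orthonormal_basis g D.
have sp := orthonormal_spans os sD ss; rewrite dD in ss.
have [f of_ fE] := orthonormal_frame_of os dn.
pose z := f ord0.
have zs : s = [:: z].
  by rewrite /z fE ?ss //; case: (s) ss => [|a []].
have zD : z \in D by rewrite sD // zs mem_head.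
have derivedE x y : br x y = g (br x y) z *: z.
  have := @orthonormal_span _ _ g s (br x y) os; rewrite sp => /(_ (mem_derived _ _ _)).
  by rewrite ss big_ord1 zs.
pose b (i : 'I_6) := f (lift ord0 i).
have ob : orthonormal_frame g b by move=> i j; rewrite of_ (inj_eq lift_inj).
pose w x y := g (br x y) z.
have lw x : scalar (w x).
  by move=> c u v; rewrite /w bracketDr bracketZr dotDl dotZl.
have aw x y : w y x = - w x y by rewrite /w bracket_antisym // dotNl.
have [e [oe se crit]] := max_complex_frame ob lw aw.
pose E (i : 'I_7) := if unlift ord0 i is Some j then e j else z.
have ze i : g z (e i) = 0.
  by apply: (in_span_orthogonal (se i)) => j; rewrite of_ -val_eqE.
have oE : orthonormal_frame g E.
  move=> i j; rewrite /E; case: (unliftP ord0 i) => [i'|] ->; case: (unliftP ord0 j) => [j'|] ->.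
  - by rewrite oe (inj_eq lift_inj).
  - by rewrite dotC ze.
  - by rewrite ze.
  - by rewrite of_.
have E0 : E (inord 0) = z.
  rewrite /E (_ : inord 0 = ord0) ?unlift_none //.
  by apply: val_inj; rewrite /= inordK.
have ES k : (k < 6)%N -> E (inord k.+1) = e (inord k).
  move=> k6; rewrite /E (_ : inord k.+1 = lift ord0 (inord k)) ?liftK //.
  by apply: val_inj; rewrite /= !inordK.
have wDl x y u c t : w (c *: x + t *: y) u = c * w x u + t * w y u.
  by rewrite /w bracketDl !bracketZl dotDl !dotZl.
have wDr x y u c t : w u (c *: x + t *: y) = c * w u x + t * w u y.
  by rewrite /w bracketDr !bracketZr dotDl !dotZl.
have ne i j : (i < 6)%N -> (j < 6)%N -> (inord i == inord j :> 'I_6) = (i == j).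
  by move=> i6 j6; rewrite -val_eqE /= !inordK.
(* [d] is the contribution of the pair that the rotation does not touch, and [B] is the first
   variation. *)
have crit' i j B d : (i < 6)%N -> (j < 6)%N -> i != j ->
  (forall c t, let f := rotate (inord i) (inord j) c t e in
    w (f (inord 0)) (f (inord 1)) + w (f (inord 2)) (f (inord 3)) + w (f (inord 4)) (f (inord 5)) =
    c * (w (e (inord 0)) (e (inord 1)) + w (e (inord 2)) (e (inord 3)) + w (e (inord 4)) (e (inord 5)) - d)
    + t * B + d) -> B = 0.
  move=> i6 j6 ij H; apply: (@rotation_critical _ (w (e (inord 0)) (e (inord 1)) +
     w (e (inord 2)) (e (inord 3)) + w (e (inord 4)) (e (inord 5)) - d) _ d) => c t ct.
  have := crit c t (inord i) (inord j); rewrite ne // => /(_ ij ct) /=; rewrite H.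
  by rewrite subrK.
exists (g2_model g E); split; last by exists (frame_volume g E); apply: g2_model_induces.
apply: (line_coclosed hlie dn oE) => [x|i x y /andP[i0 i7]|||||| ].
- by rewrite E0 cD.
- case: i i0 i7 => // i _ i6; rewrite derivedE dotZl ES // ze mulr0 //.
all: rewrite ?E0 ?(ES 0%N) ?(ES 1%N) ?(ES 2%N) ?(ES 3%N) ?(ES 4%N) ?(ES 5%N) // -/(w _ _).
(* Each rotation mixes one vector from each of two of the pairs (0,1), (2,3), (4,5); the last
   argument is w on the third pair. Indices of [e] are one less than those of [E]. *)
- apply/eqP; rewrite -subr_eq0; apply/eqP.
  apply: (crit' 3%N 0%N _ (w (e (inord 4)) (e (inord 5)))) => // c t /=.
  rewrite /rotate !ne //= ?wDl ?wDr (aw (e (inord 1)) (e (inord 3))) (aw (e (inord 0)) (e (inord 2))); ring.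
- apply/eqP; rewrite -subr_eq0; apply/eqP.
  apply: (crit' 2%N 0%N _ (w (e (inord 4)) (e (inord 5)))) => // c t /=.
  rewrite /rotate !ne //= ?wDl ?wDr (aw (e (inord 1)) (e (inord 2))); ring.
- apply/eqP; rewrite -subr_eq0; apply/eqP.
  apply: (crit' 5%N 0%N _ (w (e (inord 2)) (e (inord 3)))) => // c t /=.
  rewrite /rotate !ne //= ?wDl ?wDr (aw (e (inord 1)) (e (inord 5))) (aw (e (inord 0)) (e (inord 4))); ring.
- apply/eqP; rewrite -subr_eq0; apply/eqP.
  apply: (crit' 4%N 0%N _ (w (e (inord 2)) (e (inord 3)))) => // c t /=.
  rewrite /rotate !ne //= ?wDl ?wDr (aw (e (inord 1)) (e (inord 4))); ring.
- apply/eqP; rewrite -subr_eq0; apply/eqP.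
  apply: (crit' 5%N 2%N _ (w (e (inord 0)) (e (inord 1)))) => // c t /=.
  rewrite /rotate !ne //= ?wDl ?wDr (aw (e (inord 3)) (e (inord 5))) (aw (e (inord 2)) (e (inord 4))); ring.
- apply/eqP; rewrite -subr_eq0; apply/eqP.
  apply: (crit' 4%N 2%N _ (w (e (inord 0)) (e (inord 1)))) => // c t /=.
  rewrite /rotate !ne //= ?wDl ?wDr (aw (e (inord 3)) (e (inord 4))); ring.
Qed.

End Existence.

(** * Dimension of the derived algebra and central vectors of reducible algebras *)

Section Structure.
Variables (R : realType) (n : vectType R) (br : {bilinear n -> n -> n}).
Hypotheses (hlie : is_lie_bracket br) (dn : \dim {:n} = 7%N).
Hypothesis hnil : is_two_step_nilpotent br.
Local Notation D := (derived_algebra br).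

(** If dim D were at least 4, a complement of the central D would have dimension at most 3, and the
    brackets of its at most three basis vectors would span D. *)
Lemma derived_dim_le3 : (\dim D <= 3)%N.
Proof.
have [_ cD] := hnil; rewrite leqNgt; apply/negP => D4.
pose v := vbasis (D^C)%VS.
have sv : (size v <= 3)%N by rewrite size_tuple dimv_compl dn; lia.
(* When the complement has dimension below 3, the missing entries are the default 0. *)
pose t := [:: v`_0; v`_1; v`_2].
have sp c : c \in (D^C)%VS -> c = \sum_(i < 3) coord (in_tuple t) i c *: t`_i.
  move=> cC; apply: (coord_span (X := in_tuple t)).
  move: cC; rewrite -(span_basis (vbasisP (D^C)%VS)); apply/subvP/sub_span => x.
  move=> /(nthP 0)[i]; rewrite -/v => iv <-.
  have : (i < 3)%N by apply: leq_trans sv.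
  by case: i {iv} => [|[|[|]]] // _; rewrite !inE eqxx ?orbT.
pose U := <<[:: br v`_0 v`_1; br v`_0 v`_2; br v`_1 v`_2]>>%VS.
have tU i j : (i < 3)%N -> (j < 3)%N -> br t`_i t`_j \in U.
  have [alt _] := hlie.
  have m0 : br v`_0 v`_1 \in U by rewrite memv_span // !inE eqxx.
  have m1 : br v`_0 v`_2 \in U by rewrite memv_span // !inE eqxx orbT.
  have m2 : br v`_1 v`_2 \in U by rewrite memv_span // !inE eqxx !orbT.
  case: i => [|[|[|]]] // _; case: j => [|[|[|]]] //= _;
    rewrite ?alt ?mem0v // bracket_antisym ?memvN //.
have brU x y : br x y \in U.
  have full z : exists2 d, d \in D & exists2 c, c \in (D^C)%VS & z = d + c.
    have : z \in (D + D^C)%VS by rewrite addv_complf memvf.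
    by move=> /memv_addP[d dD [c cC zE]]; exists d => //; exists c.
  have [d dD [c cC ->]] := full x; have [d' dD' [c' cC' ->]] := full y.
  rewrite bracketDl (cD _ dD) add0r bracketDr bracket_antisym // (cD _ dD') oppr0 add0r.
  rewrite (sp _ cC) (sp _ cC') bracket_suml; apply: memv_suml => i _.
  rewrite bracket_sumr; apply: memv_suml => j _.
  by rewrite bracketZl bracketZr !memvZ // tU.
have /dimvS le : (D <= U)%VS.
  by apply/span_subvP => _ /allpairsP[[x y] [_ _ ->]].
by have := leq_trans D4 (leq_trans le (dim_span _)).
Qed.

(* If the center is no larger than D, then D is the sum of the lines D & I and D & J;
   choosing z orthogonal to neither, a kernel vector of the skew form g([-, -], z) on
   the 5-dimensional orthogonal complement of D is central after all. *)
Lemma reducible_central (g : {dot n for idfun}) : \dim D = 2%N -> is_reducible br ->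
  exists2 u, is_central br u & u \notin D.
Proof.
move=> dD [I [J [[iI iJ] [I0 J0] IJ IJ0]]].
have [_ cD] := hnil.
(* An ideal K that meets D in 0 is central, because [x, K] lies in both. *)
have outside (K : {vspace n}) : is_ideal br K -> K != 0%VS -> (D :&: K = 0)%VS ->
    exists2 u, is_central br u & u \notin D.
  move=> iK K0 DK; exists (vpick K).
    move=> y; rewrite bracket_antisym //; apply/eqP; rewrite oppr_eq0 -memv0 -DK.
    by rewrite memv_cap mem_derived iK // memv_pick.
  apply: contra K0 => kD; rewrite -vpick0 -memv0 -DK.
  by rewrite memv_cap kD memv_pick.
have [/(outside _ iI I0)//|DI] := eqVneq (D :&: I)%VS 0%VS.
have [/(outside _ iJ J0)//|DJ] := eqVneq (D :&: J)%VS 0%VS.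
(* D & I and D & J are independent inside the plane D, so when both are nonzero each is a line. *)
have dsum : (\dim (D :&: I) + \dim (D :&: J) <= 2)%N.
  rewrite -dimv_disjoint_sum -?dD.
    by apply: dimvS; rewrite subv_add !capvSl.
  apply/eqP; rewrite -subv0 -IJ0; apply/subvP => x.
  by rewrite !memv_cap => /andP[/andP[_ ->] /andP[_ ->]].
have line (K : {vspace n}) : (D :&: K != 0)%VS -> (\dim (D :&: K) <= 1)%N ->
    (D :&: K)%VS = <[vpick (D :&: K)%VS]>%VS.
  move=> K0 K1; apply/eqP; rewrite eq_sym eqEdim dim_vline vpick0 K0 K1 andbT.
  by rewrite -memvE memv_pick.
have dI : (\dim (D :&: I) <= 1)%N by move: DI DJ; rewrite -!dimv_eq0; lia.
have dJ : (\dim (D :&: J) <= 1)%N by move: DI DJ; rewrite -!dimv_eq0; lia.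
pose z1 := vpick (D :&: I)%VS; pose z2 := vpick (D :&: J)%VS.
have z10 : 0 < g z1 z1 by rewrite dot_gt0 // vpick0.
have z20 : 0 < g z2 z2 by rewrite dot_gt0 // vpick0.
(* z1 itself works unless it is orthogonal to z2, in which case z1 + z2 does. *)
have [z [gz1 gz2]] : exists z, g z1 z != 0 /\ g z2 z != 0.
  have [z12|z12] := eqVneq (g z2 z1) 0.
    by exists (z1 + z2); rewrite !dotDr z12 [g z1 z2]dotC z12 addr0 add0r !gt_eqF.
  by exists z1; rewrite gt_eqF.
have [s [os sD ss]] := orthonormal_basis g D.
have sp := orthonormal_spans os sD ss; rewrite dD in ss.
have [f of_ fE] := orthonormal_frame_of os dn.
have fs (i : 'I_7) : (i < 2)%N -> f i = s`_i by move=> i2; rewrite fE ?ss.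
have fD (i : 'I_7) : (i < 2)%N -> f i \in D.
  by move=> i2; rewrite fs // sD // mem_nth // ss.
have perp x (i : 'I_7) : x \in D -> (1 < i)%N -> g x (f i) = 0.
  rewrite -sp => /(orthonormal_span os) -> i2; rewrite dot_suml big1 // => j _.
  have j2 : (j < 2)%N by rewrite -ss.
  have j7 : (j < 7)%N by apply: leq_trans j2 _.
  rewrite dotZl -[s`_j](fs (Ordinal j7)) // of_ -val_eqE /= ltn_eqF ?mulr0 //.
  exact: leq_trans i2.
pose w x y := g (br x y) z.
pose h (i : 'I_5) : 'I_7 := rshift 2 i.
pose A : 'M[R]_5 := \matrix_(i, j) w (f (h i)) (f (h j)).
have [c c0 cA] : exists2 c : 'rV[R]_5, c != 0 & c *m A = 0.
  apply: skew_odd_ker => //; apply/matrixP => i j.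
  by rewrite !mxE /w bracket_antisym // dotNl.
pose x := \sum_i c 0 i *: f (h i).
have gx i : g x (f (h i)) = c 0 i.
  rewrite dot_suml (bigD1 i) //= big1 ?addr0 => [|j ji].
    by rewrite dotZl of_ eqxx mulr1.
  by rewrite dotZl of_ (inj_eq (@rshift_inj 2 5)) (negPf ji) mulr0.
have wx y : w x y = 0.
  rewrite /w (frame_expand y dn of_) bracket_sumr dot_suml big1 // => j _.
  rewrite bracketZr dotZl; have [j2|j2] := ltnP j 2.
    by rewrite bracket_antisym // cD ?fD // oppr0 dot0l mulr0.
  have j5 : (j - 2 < 5)%N by rewrite ltn_subLR.
  have jE : j = h (Ordinal j5) by apply: val_inj; rewrite /= subnKC.
  have := congr1 (fun M : 'rV_5 => M 0 (Ordinal j5)) cA; rewrite !mxE => E.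
  rewrite bracket_suml dot_suml (_ : \sum_i _ = 0) ?mulr0 // -[RHS]E.
  apply: eq_bigr => i _; rewrite mxE bracketZl dotZl; congr (_ * _).
  by rewrite /w [in LHS]jE.
exists x; last first.
  apply: contra c0 => xD; apply/eqP/rowP => i.
  by rewrite -gx perp // mxE.
(* For y in K, [x, y] is a multiple of z0; since w x y = 0 and g z0 z is nonzero, the multiple
   vanishes. *)
have half (K : {vspace n}) z0 y : is_ideal br K -> (D :&: K)%VS = <[z0]>%VS ->
    g z0 z != 0 -> y \in K -> br x y = 0.
  move=> iK DK gz yK; have : br x y \in <[z0]>%VS.
    by rewrite -DK memv_cap mem_derived iK.
  move=> /vlineP[a aE]; have := wx y; rewrite /w aE dotZl => /eqP.
  by rewrite mulf_eq0 (negPf gz) orbF => /eqP ->; rewrite scale0r.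
move=> y; have : y \in (I + J)%VS by rewrite IJ memvf.
move=> /memv_addP[yI yII [yJ yJJ ->]]; rewrite bracketDr.
rewrite (half I z1 yI iI (line _ DI dI) gz1 yII) add0r.
exact: (half J z2 yJ iJ (line _ DJ dJ) gz2 yJJ).
Qed.

End Structure.

Theorem theorem1p1 (R : realType) (n : vectType R)
    (br : {bilinear n -> n -> n}) (hlie : is_lie_bracket br)
    (hdim : \dim {:n} = 7%N) (hnil : is_two_step_nilpotent br) :
  (is_irreducible br -> \dim (derived_algebra br) = 2%N ->
     ~ exists phi : ('I_3 -> n) -> R, is_coclosed_g2 br phi)
  /\
  (is_reducible br \/ \dim (derived_algebra br) <> 2%N ->
     forall g : {dot n for idfun},
       exists phi : ('I_3 -> n) -> R,
         is_coclosed_g2 br phi /\ g2_metric phi g).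
Proof.
have [[x0 [y0 nab]] cD] := hnil.
split=> [irr D2 [phi cc]|red g]; first exact: irr (coclosed_reducible hlie hdim hnil D2 cc).
(* Non-commutativity excludes dimension 0, which leaves 1, 2 and 3. *)
have D0 : \dim (derived_algebra br) != 0%N.
  rewrite dimv_eq0; apply: contraNneq nab => D0.
  by have := mem_derived br x0 y0; rewrite D0 memv0.
have := derived_dim_le3 hlie hdim hnil; rewrite leq_eqVlt => /orP[/eqP D3|].
  exact: (coclosed_of_center hlie g hdim D3 cD (subvv _)).
rewrite ltnS leq_eqVlt => /orP[/eqP D2|]; last first.
  rewrite ltnS leq_eqVlt ltnS leqn0 (negPf D0) orbF => /eqP D1.
  exact: (coclosed_of_line hlie g hdim D1 cD).
case: red => // red.
have [u cu uD] := reducible_central hlie hdim hnil g D2 red.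
(* The central vector u outside D supplies the third dimension of the central subspace. *)
apply: (coclosed_of_center hlie g hdim (W := (derived_algebra br + <[u]>)%VS)).
- rewrite dimv_disjoint_sum ?D2 ?dim_vline.
    by rewrite (_ : u != 0) //; apply: contraNneq uD => ->; apply: mem0v.
  apply/eqP; rewrite -subv0; apply/subvP => v; rewrite memv_cap => /andP[vD /vlineP[a vE]].
  have [a0|a0] := eqVneq a 0; first by rewrite vE a0 scale0r mem0v.
  by case/negP: uD; rewrite -[u](scalerK a0) -vE memvZ.
- move=> _ /memv_addP[d dD [_ /vlineP[a ->] ->]] y.
  by rewrite bracketDl cD // bracketZl cu scaler0 addr0.
- exact: addvSl.
Qed.
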